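(* Let $\mathfrak{g}=\mathfrak{g}(A)$ be any BKM Lie algebra, $\lambda\in\mathfrak{h}^*$, and let $V$ be any integrable highest weight $\mathfrak{g}$-module with highest weight $\lambda$. Then $$\mathrm{wt}\,V=\bigcup_{(H,m_H)\,\in\,\mathrm{Indep}(J_\lambda)\setminus\mathcal{H}_V}\mathrm{wt}\,L\Big(\lambda-\sum_{h\in H}m_H(h)\alpha_h\Big),$$ and each simple module $L(\lambda-\sum_{h\in H}m_H(h)\alpha_h)$ in this union occurs in all local Jordan--Hölder series of $V$ (taken at a weight $\nu\preceq\lambda-\sum_{h\in H}m_H(h)\alpha_h$).
   Context: BKM-Cartan matrix: a real matrix $A=(A_{ij})_{i,j\in\mathcal{I}}$, $\mathcal{I}$ finite, with $A_{ii}\in\{2\}\sqcup\mathbb{R}_{\le0}$; $A_{ij}=0\iff A_{ji}=0$; $A_{ij}\in\mathbb{R}_{\le 0}$ for $i\ne j$; and $A_{ij}\in\mathbb{Z}_{\le0}$ whenever $A_{ii}=2$, $j\neq i$. Put $\mathcal{I}^+=\{i: A_{ii}=2\}$, $\mathcal{I}^0=\{i:A_{ii}=0\}$, $\mathcal{I}^-=\{i:A_{ii}<0\}$. The BKM Lie algebra $\mathfrak{g}=\mathfrak{g}(A)$ over $\mathbb{C}$ has Cartan subalgebra $\mathfrak{h}$ ($\dim\mathfrak{h}=|\mathcal{I}|+\text{nullity}(A)$), linearly independent simple roots $\Pi=\{\alpha_i\}\subset\mathfrak{h}^*$ and simple co-roots $\{\alpha_i^\vee\}\subset\mathfrak{h}$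 with $\alpha_j(\alpha_i^\vee)=A_{ij}$, and Chevalley generators $e_i,f_i$ ($i\in\mathcal I$), with the usual relations ($[h,e_i]=\alpha_i(h)e_i$, $[h,f_i]=-\alpha_i(h)f_i$, $[e_i,f_j]=\delta_{ij}\alpha_i^\vee$), the Serre relations $\mathrm{ad}_{e_i}^{1-A_{ij}}(e_j)=0=\mathrm{ad}_{f_i}^{1-A_{ij}}(f_j)$ for $i\in\mathcal{I}^+$, $j\ne i$, and $[e_i,e_j]=[f_i,f_j]=0$ when $A_{ij}=0$. The Dynkin graph has vertex set $\mathcal{I}$ with an edge between $i\ne j$ iff $A_{ij}\neq0$; $H\subseteq\mathcal{I}$ is independent if it has no edges between its nodes. $\mu\preceq\lambda$ means $\lambda-\mu\in\mathbb{Z}_{\ge0}\Pi$. $M(\lambda)$ is the Verma module, $L(\lambda)$ its simple quotient; a highest weight module of highest weight $\lambda$ is a nonzero quotient $V$ of $M(\lambda)$, with weight spaces $V_\mu$ and weight set $\mathrm{wt}\,V$. $V$ is integrable if for all $i\in\mathcal{I}^+$: $\lambda(\alpha_i^\vee)\in\mathbb{Z}_{\ge0}$ and $f_i^{\lambda(\alpha_i^\vee)+1}V_\lambda=0$. $J_\lambda:=\{i\in\mathcal{I}: \lambda(\alpha_i^\vee)\in\frac{A_{ii}}{2}\mathbb{Z}_{\ge0}\}$. $\mathrm{Indep}(J_\lambda)$ is the set of pairs $(H,m_H)$ with $H\subseteq J_\lambda$ independent and $m_H:H\to\mathbb{Z}_{\geq 0}$ satisfying $m_H(h)=\frac{2}{A_{hh}}\lambda(\alpha_h^\vee)+1$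 for $h\in H\cap(\mathcal{I}^+\sqcup\mathcal{I}^-)$ and $m_H(h)\ge1$ arbitrary for $h\in H\cap\mathcal{I}^0$; the trivial pair with $H=\emptyset$ (contributing the weight $\lambda$) is included. $\mathcal{H}_V$ (the holes of $V$) is the set of those $(H,m_H)\in\mathrm{Indep}(J_\lambda)$ with $\big(\prod_{h\in H}f_h^{m_H(h)}\big)V_\lambda=0$ (so the trivial pair is not in $\mathcal{H}_V$). A local Jordan--Hölder series of $V$ at a weight $\nu$ is a finite filtration $V=V_t\supseteq V_{t-1}\supseteq\cdots\supseteq V_0=0$ by submodules such that for each $j$, either $V_j/V_{j-1}\cong L(\eta_j)$ for some $\eta_j\succeq\nu$, or $(V_j/V_{j-1})_\eta=0$ for all $\eta\succeq\nu$; the simples occurring in it are the $L(\eta_j)$'s of the first kind. *)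

(* Defs.v *)
From HB Require Import structures.
From mathcomp Require Import all_boot all_order all_algebra.
From mathcomp Require Import boolp classical_sets reals complex.

Set Implicit Arguments.
Unset Strict Implicit.
Unset Printing Implicit Defensive.

Import Order.TTheory GRing.Theory Num.Theory.
Local Open Scope ring_scope.

(* A K-vector space up to an equivalence relation: every vector space below
   that is given by generators and relations, or as a quotient by a subspace,
   is the quotient [lquot] of such a "pre-vector space". *)
Record prelmod (K : fieldType) := PreLmod {
  pl_car :> Type;
  pl_zero : pl_car;
  pl_add : pl_car -> pl_car -> pl_car;
  pl_scale : K -> pl_car -> pl_car;
  pl_eq : pl_car -> pl_car -> Prop;
  pl_refl : forall x, pl_eq x x;
  pl_sym : forall x y, pl_eq x y -> pl_eq y x;
  pl_trans : forall x y z, pl_eq x y -> pl_eq y z -> pl_eq x z;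
  pl_addE : forall x x' y y',
    pl_eq x x' -> pl_eq y y' -> pl_eq (pl_add x y) (pl_add x' y');
  pl_scaleE : forall c x x', pl_eq x x' -> pl_eq (pl_scale c x) (pl_scale c x');
  pl_addA : forall x y z, pl_eq (pl_add x (pl_add y z)) (pl_add (pl_add x y) z);
  pl_addC : forall x y, pl_eq (pl_add x y) (pl_add y x);
  pl_add0 : forall x, pl_eq (pl_add pl_zero x) x;
  pl_addN : forall x, pl_eq (pl_add (pl_scale (-1) x) x) pl_zero;
  pl_scaleA : forall a b x, pl_eq (pl_scale a (pl_scale b x)) (pl_scale (a * b) x);
  pl_scale1 : forall x, pl_eq (pl_scale 1 x) x;
  pl_scaleDr : forall a x y,
    pl_eq (pl_scale a (pl_add x y)) (pl_add (pl_scale a x) (pl_scale a y));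
  pl_scaleDl : forall a b x,
    pl_eq (pl_scale (a + b) x) (pl_add (pl_scale a x) (pl_scale b x))
}.

Section LinearQuotient.
Variables (K : fieldType) (P : prelmod K).

Definition pl_choice : Type := pl_car P.
HB.instance Definition _ := gen_eqMixin pl_choice.
HB.instance Definition _ := gen_choiceMixin pl_choice.

Definition pl_eqb (x y : pl_choice) : bool := `[< pl_eq (p := P) x y >].

Lemma pl_eqb_refl : reflexive pl_eqb.
Proof. by move=> x; apply/asboolP; apply: pl_refl. Qed.

Lemma pl_eqb_sym : symmetric pl_eqb.
Proof. by move=> x y; apply/asboolP/asboolP; apply: pl_sym. Qed.

Lemma pl_eqb_trans : transitive pl_eqb.
Proof.
by move=> y x z /asboolP xy /asboolP yz; apply/asboolP; apply: pl_trans xy yz.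
Qed.

Canonical pl_equiv := EquivRel pl_eqb pl_eqb_refl pl_eqb_sym pl_eqb_trans.

Definition lquot := {eq_quot pl_equiv}%qT.
HB.instance Definition _ := Choice.on lquot.

Definition lq (x : P) : lquot := (\pi_{eq_quot pl_equiv} (x : pl_choice))%qT.
Definition lrepr (q : lquot) : P := repr (q : {eq_quot pl_equiv}%qT).

Lemma lreprK q : lq (lrepr q) = q.
Proof. exact: reprK. Qed.

Lemma lqP x y : lq x = lq y <-> pl_eq x y.
Proof.
by split=> [/eqquotP/asboolP//|xy]; apply/eqquotP; apply/asboolP.
Qed.

Lemma lrepr_lq x : pl_eq (lrepr (lq x)) x.
Proof. by apply/lqP; rewrite lreprK. Qed.

Definition lq_add (p q : lquot) := lq (pl_add (lrepr p) (lrepr q)).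
Definition lq_opp (p : lquot) := lq (pl_scale (-1) (lrepr p)).
Definition lq_scale (c : K) (p : lquot) := lq (pl_scale c (lrepr p)).

Lemma lq_addE x y : lq_add (lq x) (lq y) = lq (pl_add x y).
Proof. by apply/lqP; apply: pl_addE; apply: lrepr_lq. Qed.

Lemma lq_scaleE c x : lq_scale c (lq x) = lq (pl_scale c x).
Proof. by apply/lqP; apply: pl_scaleE; apply: lrepr_lq. Qed.

Lemma lq_addA : associative lq_add.
Proof.
move=> p q r; rewrite -[p]lreprK -[q]lreprK -[r]lreprK !lq_addE.
by apply/lqP; apply: pl_addA.
Qed.

Lemma lq_addC : commutative lq_add.
Proof. by move=> p q; apply/lqP; apply: pl_addC. Qed.

Lemma lq_add0 : left_id (lq (pl_zero P)) lq_add.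
Proof. by move=> p; rewrite -[p]lreprK lq_addE; apply/lqP; apply: pl_add0. Qed.

Lemma lq_addN : left_inverse (lq (pl_zero P)) lq_opp lq_add.
Proof.
move=> p; rewrite -[X in lq_add _ X]lreprK /lq_opp lq_addE.
by apply/lqP; apply: pl_addN.
Qed.

HB.instance Definition _ :=
  GRing.isZmodule.Build lquot lq_addA lq_addC lq_add0 lq_addN.

Lemma lq_scaleA a b p : lq_scale a (lq_scale b p) = lq_scale (a * b) p.
Proof. by rewrite -[p]lreprK !lq_scaleE; apply/lqP; apply: pl_scaleA. Qed.

Lemma lq_scale1 : left_id 1 lq_scale.
Proof. by move=> p; rewrite -[p]lreprK lq_scaleE; apply/lqP; apply: pl_scale1. Qed.

Lemma lq_scaleDr : right_distributive lq_scale +%R.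
Proof.
move=> a p q; rewrite -[p]lreprK -[q]lreprK.
transitivity (lq_add (lq_scale a (lq (lrepr p))) (lq_scale a (lq (lrepr q)))) => //.
rewrite [_ + _]lq_addE !lq_scaleE lq_addE.
by apply/lqP; apply: pl_scaleDr.
Qed.

Lemma lq_scaleDl p : {morph lq_scale^~ p : a b / a + b}.
Proof.
move=> a b; rewrite -[p]lreprK /= !lq_scaleE.
transitivity (lq_add (lq (pl_scale a (lrepr p))) (lq (pl_scale b (lrepr p)))) => //.
by rewrite lq_addE; apply/lqP; apply: pl_scaleDl.
Qed.

HB.instance Definition _ :=
  GRing.Zmodule_isLmodule.Build K lquot lq_scaleA lq_scale1 lq_scaleDr lq_scaleDl.

Lemma lqD x y : lq (pl_add x y) = lq x + lq y.
Proof. by rewrite -lq_addE. Qed.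

Lemma lqZ c x : lq (pl_scale c x) = c *: lq x.
Proof. by rewrite -lq_scaleE. Qed.

Lemma lq0 : lq (pl_zero P) = 0.
Proof. by []. Qed.

End LinearQuotient.

Record lieAlgebra (K : fieldType) := LieAlgebra {
  lie_car :> lmodType K;
  bracket : lie_car -> lie_car -> lie_car;
  bracketDl : forall x y z, bracket (x + y) z = bracket x z + bracket y z;
  bracketDr : forall x y z, bracket x (y + z) = bracket x y + bracket x z;
  bracketZl : forall c x y, bracket (c *: x) y = c *: bracket x y;
  bracketZr : forall c x y, bracket x (c *: y) = c *: bracket x y;
  bracketxx : forall x, bracket x x = 0;
  jacobi : forall x y z,
    bracket x (bracket y z) + bracket y (bracket z x) + bracket z (bracket x y) = 0
}.

(* The Lie algebra presented by a type X of generators and a family rel of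
   relations between Lie words in these generators: it is the quotient of the
   set of words by the congruence generated by rel and the Lie algebra laws. *)
Section LiePresentation.
Variables (K : fieldType) (X : Type).

Inductive lie_word :=
  | LGen of X
  | LZero
  | LAdd of lie_word & lie_word
  | LScale of K & lie_word
  | LBr of lie_word & lie_word.

Variable rel : lie_word -> lie_word -> Prop.

Inductive lie_eq : lie_word -> lie_word -> Prop :=
  | lw_rel x y : rel x y -> lie_eq x y
  | lw_refl x : lie_eq x x
  | lw_sym x y : lie_eq x y -> lie_eq y x
  | lw_trans x y z : lie_eq x y -> lie_eq y z -> lie_eq x z
  | lw_addE x x' y y' :
      lie_eq x x' -> lie_eq y y' -> lie_eq (LAdd x y) (LAdd x' y')
  | lw_scaleE c x x' : lie_eq x x' -> lie_eq (LScale c x) (LScale c x')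
  | lw_brE x x' y y' : lie_eq x x' -> lie_eq y y' -> lie_eq (LBr x y) (LBr x' y')
  | lw_addA x y z : lie_eq (LAdd x (LAdd y z)) (LAdd (LAdd x y) z)
  | lw_addC x y : lie_eq (LAdd x y) (LAdd y x)
  | lw_add0 x : lie_eq (LAdd LZero x) x
  | lw_addN x : lie_eq (LAdd (LScale (-1) x) x) LZero
  | lw_scaleA a b x : lie_eq (LScale a (LScale b x)) (LScale (a * b) x)
  | lw_scale1 x : lie_eq (LScale 1 x) x
  | lw_scaleDr a x y : lie_eq (LScale a (LAdd x y)) (LAdd (LScale a x) (LScale a y))
  | lw_scaleDl a b x : lie_eq (LScale (a + b) x) (LAdd (LScale a x) (LScale b x))
  | lw_brDl x y z : lie_eq (LBr (LAdd x y) z) (LAdd (LBr x z) (LBr y z))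
  | lw_brDr x y z : lie_eq (LBr x (LAdd y z)) (LAdd (LBr x y) (LBr x z))
  | lw_brZl c x y : lie_eq (LBr (LScale c x) y) (LScale c (LBr x y))
  | lw_brZr c x y : lie_eq (LBr x (LScale c y)) (LScale c (LBr x y))
  | lw_brxx x : lie_eq (LBr x x) LZero
  | lw_jacobi x y z :
      lie_eq (LAdd (LAdd (LBr x (LBr y z)) (LBr y (LBr z x))) (LBr z (LBr x y))) LZero.

Definition lie_pre : prelmod K :=
  PreLmod lw_refl lw_sym lw_trans lw_addE lw_scaleE lw_addA lw_addC lw_add0
    lw_addN lw_scaleA lw_scale1 lw_scaleDr lw_scaleDl.

Definition lie_class (x : lie_word) : lquot lie_pre := lq (P := lie_pre) x.

Definition lie_br (p q : lquot lie_pre) : lquot lie_pre :=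
  lie_class (LBr (lrepr p) (lrepr q)).

Lemma lie_brE x y : lie_br (lie_class x) (lie_class y) = lie_class (LBr x y).
Proof. by apply/lqP; apply: lw_brE; apply: (lrepr_lq (P := lie_pre)). Qed.

Lemma lie_classD x y : lie_class x + lie_class y = lie_class (LAdd x y).
Proof. by rewrite /lie_class -lqD. Qed.

Lemma lie_classZ c x : c *: lie_class x = lie_class (LScale c x).
Proof. by rewrite /lie_class -lqZ. Qed.

Lemma lie_classP (p : lquot lie_pre) : exists x, p = lie_class x.
Proof. by exists (lrepr p); rewrite /lie_class lreprK. Qed.

Lemma lie_brDl x y z : lie_br (x + y) z = lie_br x z + lie_br y z.
Proof.
case: (lie_classP x) (lie_classP y) (lie_classP z) => {}x -> [{}y ->] [{}z ->].
by rewrite lie_classD !lie_brE lie_classD; apply/lqP; apply: lw_brDl.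
Qed.

Lemma lie_brDr x y z : lie_br x (y + z) = lie_br x y + lie_br x z.
Proof.
case: (lie_classP x) (lie_classP y) (lie_classP z) => {}x -> [{}y ->] [{}z ->].
by rewrite lie_classD !lie_brE lie_classD; apply/lqP; apply: lw_brDr.
Qed.

Lemma lie_brZl c x y : lie_br (c *: x) y = c *: lie_br x y.
Proof.
case: (lie_classP x) (lie_classP y) => {}x -> [{}y ->].
by rewrite lie_classZ !lie_brE lie_classZ; apply/lqP; apply: lw_brZl.
Qed.

Lemma lie_brZr c x y : lie_br x (c *: y) = c *: lie_br x y.
Proof.
case: (lie_classP x) (lie_classP y) => {}x -> [{}y ->].
by rewrite lie_classZ !lie_brE lie_classZ; apply/lqP; apply: lw_brZr.
Qed.

Lemma lie_brxx x : lie_br x x = 0.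
Proof.
case: (lie_classP x) => {}x ->.
by rewrite lie_brE; apply/lqP; apply: lw_brxx.
Qed.

Lemma lie_jacobi x y z :
  lie_br x (lie_br y z) + lie_br y (lie_br z x) + lie_br z (lie_br x y) = 0.
Proof.
case: (lie_classP x) (lie_classP y) (lie_classP z) => {}x -> [{}y ->] [{}z ->].
by rewrite !lie_brE !lie_classD; apply/lqP; apply: lw_jacobi.
Qed.

Definition presented_lie : lieAlgebra K :=
  LieAlgebra lie_brDl lie_brDr lie_brZl lie_brZr lie_brxx lie_jacobi.

End LiePresentation.

Arguments LZero {K X}.
Arguments LGen {K X}.

Record lieModule (K : fieldType) (g : lieAlgebra K) := LieModule {
  mod_car :> lmodType K;
  act : g -> mod_car -> mod_car;
  actDl : forall x y v, act (x + y) v = act x v + act y v;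
  actDr : forall x v w, act x (v + w) = act x v + act x w;
  actZl : forall c x v, act (c *: x) v = c *: act x v;
  actZr : forall c x v, act x (c *: v) = c *: act x v;
  act_bracket : forall x y v,
    act (bracket x y) v = act x (act y v) - act y (act x v)
}.

Section Modules.
Variables (K : fieldType) (g : lieAlgebra K).
Implicit Types M V W : lieModule g.

Definition is_hom V W (f : {linear V -> W}) : Prop :=
  forall x v, f (act x v) = act x (f v).

Definition quotient_of M V : Prop :=
  exists f : {linear M -> V}, is_hom f /\ forall w, exists v, f v = w.

Definition isomorphic V W : Prop :=
  exists f : {linear V -> W}, is_hom f /\ bijective f.

Record submodule M := Submodule {
  sub_mem :> {pred M};
  sub_closed : submod_closed sub_mem;
  sub_act : forall x v, v \in sub_mem -> act x v \in sub_mem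
}.

Section SubQuotient.
Variables (M : lieModule g) (N : submodule M).

HB.instance Definition _ :=
  GRing.isSubmodClosed.Build K M (sub_mem N) (sub_closed N).

Definition subm : Type := {v : M | v \in sub_mem N}.
HB.instance Definition _ := SubChoice.on subm.
HB.instance Definition _ := [SubChoice_isSubLmodule of subm by <:].

Definition subm_act (x : g) (v : subm) : subm :=
  Sub (act x (val v)) (sub_act x (valP v)).

Lemma subm_actDl x y v : subm_act (x + y) v = subm_act x v + subm_act y v.
Proof. by apply/val_inj; rewrite /= actDl. Qed.

Lemma subm_actDr x v w : subm_act x (v + w) = subm_act x v + subm_act x w.
Proof. by apply/val_inj; rewrite /= actDr. Qed.

Lemma subm_actZl c x v : subm_act (c *: x) v = c *: subm_act x v.
Proof. by apply/val_inj; rewrite /= actZl. Qed.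

Lemma subm_actZr c x v : subm_act x (c *: v) = c *: subm_act x v.
Proof. by apply/val_inj; rewrite /= actZr. Qed.

Lemma subm_act_bracket x y v :
  subm_act (bracket x y) v = subm_act x (subm_act y v) - subm_act y (subm_act x v).
Proof. by apply/val_inj; rewrite /= act_bracket. Qed.

Definition sub_module : lieModule g :=
  LieModule subm_actDl subm_actDr subm_actZl subm_actZr subm_act_bracket.

Definition cong (v w : M) : Prop := v - w \in sub_mem N.

Lemma cong_eq v w : v = w -> cong v w.
Proof. by move=> ->; rewrite /cong subrr rpred0. Qed.

Lemma cong_refl v : cong v v.
Proof. exact: cong_eq. Qed.

Lemma cong_sym v w : cong v w -> cong w v.
Proof. by rewrite /cong -opprB rpredN. Qed.

Lemma cong_trans u v w : cong u v -> cong v w -> cong u w.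
Proof. by move=> uv vw; rewrite /cong -(subrKA v) rpredD. Qed.

Lemma cong_addE v v' w w' : cong v v' -> cong w w' -> cong (v + w) (v' + w').
Proof. by move=> vv' ww'; rewrite /cong opprD addrACA rpredD. Qed.

Lemma cong_scaleE c v v' : cong v v' -> cong (c *: v) (c *: v').
Proof. by move=> vv'; rewrite /cong -scalerBr rpredZ. Qed.

Definition quot_pre : prelmod K :=
  @PreLmod K M 0 +%R *:%R cong cong_refl cong_sym cong_trans cong_addE cong_scaleE
    (fun x y z => cong_eq (addrA x y z)) (fun x y => cong_eq (addrC x y))
    (fun x => cong_eq (add0r x))
    (fun x => cong_eq (etrans (congr1 (+%R^~ x) (scaleN1r x)) (addNr x)))
    (fun a b x => cong_eq (scalerA a b x)) (fun x => cong_eq (scale1r x))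
    (fun a x y => cong_eq (scalerDr a x y)) (fun a b x => cong_eq (scalerDl x a b)).

Definition quot_class (v : M) : lquot quot_pre := lq (P := quot_pre) v.

Definition quot_act (x : g) (p : lquot quot_pre) : lquot quot_pre :=
  quot_class (act x (lrepr p)).

Lemma quot_actE x v : quot_act x (quot_class v) = quot_class (act x v).
Proof.
apply/lqP; rewrite /= /cong -[act x v]scale1r -scaleN1r scale1r -actZr -actDr.
by apply: sub_act; rewrite scaleN1r; apply: (lrepr_lq (P := quot_pre)).
Qed.

Lemma quot_classD v w : quot_class v + quot_class w = quot_class (v + w).
Proof. by rewrite /quot_class -lqD. Qed.

Lemma quot_classZ c v : c *: quot_class v = quot_class (c *: v).
Proof. by rewrite /quot_class -lqZ. Qed.

Lemma quot_classP (p : lquot quot_pre) : exists v, p = quot_class v.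
Proof. by exists (lrepr p); rewrite /quot_class lreprK. Qed.

Lemma quot_actDl x y p : quot_act (x + y) p = quot_act x p + quot_act y p.
Proof.
by case: (quot_classP p) => v ->; rewrite !quot_actE actDl quot_classD.
Qed.

Lemma quot_actDr x p q : quot_act x (p + q) = quot_act x p + quot_act x q.
Proof.
case: (quot_classP p) (quot_classP q) => v -> [w ->].
by rewrite quot_classD !quot_actE actDr quot_classD.
Qed.

Lemma quot_actZl c x p : quot_act (c *: x) p = c *: quot_act x p.
Proof.
by case: (quot_classP p) => v ->; rewrite !quot_actE actZl quot_classZ.
Qed.

Lemma quot_actZr c x p : quot_act x (c *: p) = c *: quot_act x p.
Proof.
by case: (quot_classP p) => v ->; rewrite quot_classZ !quot_actE actZr quot_classZ.
Qed.

Lemma quot_act_bracket x y p :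
  quot_act (bracket x y) p = quot_act x (quot_act y p) - quot_act y (quot_act x p).
Proof.
case: (quot_classP p) => v ->.
by rewrite !quot_actE act_bracket -(scaleN1r (quot_class _)) quot_classZ quot_classD scaleN1r.
Qed.

Definition quot_module : lieModule g :=
  LieModule quot_actDl quot_actDr quot_actZl quot_actZr quot_act_bracket.

End SubQuotient.

(* N2, seen inside the module N1 *)
Section Restrict.
Variables (M : lieModule g) (N1 N2 : submodule M).

Definition restr_mem : {pred sub_module N1} :=
  fun v => val (v : subm N1) \in sub_mem N2.

Lemma restr_closed : submod_closed restr_mem.
Proof.
have [N20 N2D] := sub_closed N2.
split; first by rewrite /restr_mem unfold_in /=.
by move=> c v w; rewrite !unfold_in /=; apply: N2D.
Qed.

Lemma restr_act x v : v \in restr_mem -> act x v \in restr_mem.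
Proof. by rewrite !unfold_in; apply: sub_act. Qed.

Definition restr : submodule (sub_module N1) := Submodule restr_closed restr_act.

Definition subquotient : lieModule g := quot_module restr.

End Restrict.

Definition proper_submodule M (N : submodule M) : Prop :=
  exists v, v \notin sub_mem N.

(* The sum of all proper submodules of M, as the smallest submodule that
   contains all of them. *)
Section Radical.
Variable M : lieModule g.

Definition rad_mem : {pred M} := fun v =>
  `[< forall N : submodule M,
        (forall N' : submodule M,
           proper_submodule N' -> {subset sub_mem N' <= sub_mem N}) ->
        v \in sub_mem N >].

Lemma rad_closed : submod_closed rad_mem.
Proof.
split=> [|c v w]; rewrite !unfold_in.
  by apply/asboolP => N _; have [] := sub_closed N.
move=> /asboolP Hv /asboolP Hw; apply/asboolP => N HN.
by have [_] := sub_closed N; apply; [apply: Hv | apply: Hw].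
Qed.

Lemma rad_act x v : v \in rad_mem -> act x v \in rad_mem.
Proof.
rewrite !unfold_in => /asboolP Hv; apply/asboolP => N HN.
by apply: sub_act; apply: Hv.
Qed.

Definition sum_proper : submodule M := Submodule rad_closed rad_act.

End Radical.

End Modules.

(* The g-module generated by one vector MGen subject to a family rel of
   relations, i.e. the quotient of U(g) by a left ideal. *)
Section CyclicPresentation.
Variables (K : fieldType) (g : lieAlgebra K).

Inductive mod_word :=
  | MGen
  | MZero
  | MAdd of mod_word & mod_word
  | MScale of K & mod_word
  | MAct of g & mod_word.

Variable rel : mod_word -> mod_word -> Prop.

Inductive mod_eq : mod_word -> mod_word -> Prop :=
  | mw_rel x y : rel x y -> mod_eq x y
  | mw_refl x : mod_eq x x
  | mw_sym x y : mod_eq x y -> mod_eq y x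
  | mw_trans x y z : mod_eq x y -> mod_eq y z -> mod_eq x z
  | mw_addE x x' y y' :
      mod_eq x x' -> mod_eq y y' -> mod_eq (MAdd x y) (MAdd x' y')
  | mw_scaleE c x x' : mod_eq x x' -> mod_eq (MScale c x) (MScale c x')
  | mw_actE a x x' : mod_eq x x' -> mod_eq (MAct a x) (MAct a x')
  | mw_addA x y z : mod_eq (MAdd x (MAdd y z)) (MAdd (MAdd x y) z)
  | mw_addC x y : mod_eq (MAdd x y) (MAdd y x)
  | mw_add0 x : mod_eq (MAdd MZero x) x
  | mw_addN x : mod_eq (MAdd (MScale (-1) x) x) MZero
  | mw_scaleA a b x : mod_eq (MScale a (MScale b x)) (MScale (a * b) x)
  | mw_scale1 x : mod_eq (MScale 1 x) x
  | mw_scaleDr a x y : mod_eq (MScale a (MAdd x y)) (MAdd (MScale a x) (MScale a y))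
  | mw_scaleDl a b x : mod_eq (MScale (a + b) x) (MAdd (MScale a x) (MScale b x))
  | mw_actDl a b x : mod_eq (MAct (a + b) x) (MAdd (MAct a x) (MAct b x))
  | mw_actDr a x y : mod_eq (MAct a (MAdd x y)) (MAdd (MAct a x) (MAct a y))
  | mw_actZl c a x : mod_eq (MAct (c *: a) x) (MScale c (MAct a x))
  | mw_actZr c a x : mod_eq (MAct a (MScale c x)) (MScale c (MAct a x))
  | mw_act_bracket a b x :
      mod_eq (MAct (bracket a b) x)
             (MAdd (MAct a (MAct b x)) (MScale (-1) (MAct b (MAct a x)))).

Definition mod_pre : prelmod K :=
  PreLmod mw_refl mw_sym mw_trans mw_addE mw_scaleE mw_addA mw_addC mw_add0
    mw_addN mw_scaleA mw_scale1 mw_scaleDr mw_scaleDl.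

Definition mod_class (x : mod_word) : lquot mod_pre := lq (P := mod_pre) x.

Definition mod_act (a : g) (p : lquot mod_pre) : lquot mod_pre :=
  mod_class (MAct a (lrepr p)).

Lemma mod_actE a x : mod_act a (mod_class x) = mod_class (MAct a x).
Proof. by apply/lqP; apply: mw_actE; apply: (lrepr_lq (P := mod_pre)). Qed.

Lemma mod_classD x y : mod_class x + mod_class y = mod_class (MAdd x y).
Proof. by rewrite /mod_class -lqD. Qed.

Lemma mod_classZ c x : c *: mod_class x = mod_class (MScale c x).
Proof. by rewrite /mod_class -lqZ. Qed.

Lemma mod_classP (p : lquot mod_pre) : exists x, p = mod_class x.
Proof. by exists (lrepr p); rewrite /mod_class lreprK. Qed.

Lemma mod_actDl a b p : mod_act (a + b) p = mod_act a p + mod_act b p.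
Proof.
case: (mod_classP p) => x ->.
by rewrite !mod_actE mod_classD; apply/lqP; apply: mw_actDl.
Qed.

Lemma mod_actDr a p q : mod_act a (p + q) = mod_act a p + mod_act a q.
Proof.
case: (mod_classP p) (mod_classP q) => x -> [y ->].
by rewrite mod_classD !mod_actE mod_classD; apply/lqP; apply: mw_actDr.
Qed.

Lemma mod_actZl c a p : mod_act (c *: a) p = c *: mod_act a p.
Proof.
case: (mod_classP p) => x ->.
by rewrite !mod_actE mod_classZ; apply/lqP; apply: mw_actZl.
Qed.

Lemma mod_actZr c a p : mod_act a (c *: p) = c *: mod_act a p.
Proof.
case: (mod_classP p) => x ->.
by rewrite mod_classZ !mod_actE mod_classZ; apply/lqP; apply: mw_actZr.
Qed.

Lemma mod_act_bracket a b p :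
  mod_act (bracket a b) p = mod_act a (mod_act b p) - mod_act b (mod_act a p).
Proof.
case: (mod_classP p) => x ->.
rewrite !mod_actE -scaleN1r mod_classZ mod_classD.
by apply/lqP; apply: mw_act_bracket.
Qed.

Definition cyclic_module : lieModule g :=
  LieModule mod_actDl mod_actDr mod_actZl mod_actZr mod_act_bracket.

End CyclicPresentation.

Definition BKM_Cartan (R : realType) (n : nat) (A : 'M[R]_n) : Prop :=
  [/\ forall i, A i i = 2 \/ A i i <= 0,
      forall i j, A i j = 0 <-> A j i = 0,
      forall i j, i != j -> A i j <= 0
    & forall i j, A i i = 2 -> j != i -> exists k : nat, A i j = - k%:R].

Record realization (R : realType) (n : nat) (A : 'M[R]_n) := Realization {
  cartan :> vectType R[i];
  simple_root : 'I_n -> 'Hom(cartan, R[i]^o);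
  simple_coroot : 'I_n -> cartan;
  cartan_dim : \dim {: cartan} = (n + (n - \rank A))%N;
  simple_root_free : free [seq simple_root i | i <- enum 'I_n];
  simple_coroot_free : free [seq simple_coroot i | i <- enum 'I_n];
  simple_root_coroot : forall i j, simple_root j (simple_coroot i) = (A i j)%:C%C
}.

Section BKM.
Variables (R : realType) (n : nat) (A : 'M[R]_n) (r : realization A).

Definition weight := 'Hom(r, R[i]^o).
Implicit Types (lambda mu nu eta : weight).

Inductive bkm_gen := GH of r | GE of 'I_n | GF of 'I_n.

Notation word := (lie_word R[i] bkm_gen).
Let H (h : r) : word := LGen (GH h).
Let E (i : 'I_n) : word := LGen (GE i).
Let F (i : 'I_n) : word := LGen (GF i).

(* The first two relations make h |-> GH h linear, so that the generators are
   the vector space h, the e_i and the f_i. *)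
Inductive bkm_rel : word -> word -> Prop :=
  | rel_HD h h' : bkm_rel (H (h + h')) (LAdd (H h) (H h'))
  | rel_HZ c h : bkm_rel (H (c *: h)) (LScale c (H h))
  | rel_HH h h' : bkm_rel (LBr (H h) (H h')) LZero
  | rel_HE h i : bkm_rel (LBr (H h) (E i)) (LScale (simple_root r i h) (E i))
  | rel_HF h i : bkm_rel (LBr (H h) (F i)) (LScale (- simple_root r i h) (F i))
  | rel_EF i j :
      bkm_rel (LBr (E i) (F j)) (if i == j then H (simple_coroot r i) else LZero)
  | rel_serreE i j (k : nat) : A i i = 2 -> j != i -> A i j = - k%:R ->
      bkm_rel (iter k.+1 (LBr (E i)) (E j)) LZero
  | rel_serreF i j (k : nat) : A i i = 2 -> j != i -> A i j = - k%:R ->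
      bkm_rel (iter k.+1 (LBr (F i)) (F j)) LZero
  | rel_EE i j : A i j = 0 -> bkm_rel (LBr (E i) (E j)) LZero
  | rel_FF i j : A i j = 0 -> bkm_rel (LBr (F i) (F j)) LZero.

Definition bkm : lieAlgebra R[i] := presented_lie bkm_rel.

Definition bkm_h (h : r) : bkm := lie_class bkm_rel (H h).
Definition bkm_e (i : 'I_n) : bkm := lie_class bkm_rel (E i).
Definition bkm_f (i : 'I_n) : bkm := lie_class bkm_rel (F i).

Implicit Types V W : lieModule bkm.

Definition weight_space V mu : set V :=
  [set v | forall h : r, act (bkm_h h) v = (mu h : R[i]) *: v]%classic.

Arguments weight_space : clear implicits.

Definition wt V : set weight :=
  [set mu | exists v, weight_space V mu v /\ v <> 0]%classic.

Definition weight_le mu lambda : Prop :=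
  exists c : 'I_n -> nat, lambda - mu = \sum_i simple_root r i *+ c i.

(* M(lambda) = U(g) / (U(g) n^+ + sum_h U(g) (h - lambda(h))); the e_i generate
   the Lie algebra n^+. *)
Inductive verma_rel lambda : mod_word bkm -> mod_word bkm -> Prop :=
  | verma_E i : verma_rel lambda (MAct (bkm_e i) (MGen bkm)) (MZero bkm)
  | verma_H h :
      verma_rel lambda (MAct (bkm_h h) (MGen bkm)) (MScale (lambda h) (MGen bkm)).

Definition verma lambda : lieModule bkm := cyclic_module (verma_rel lambda).

Definition simple_hw lambda : lieModule bkm :=
  quot_module (sum_proper (verma lambda)).

Definition highest_weight_module lambda V : Prop :=
  quotient_of (verma lambda) V /\ exists v : V, v <> 0.

Definition integrable lambda V : Prop :=
  forall i, A i i = 2 ->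
    exists k : nat, lambda (simple_coroot r i) = k%:R /\
      forall v, weight_space V lambda v -> iter k.+1 (act (bkm_f i)) v = 0.

Definition in_J lambda (i : 'I_n) : Prop :=
  exists k : nat, lambda (simple_coroot r i) = (A i i / 2)%:C%C * k%:R.

Definition independent (S : {set 'I_n}) : Prop :=
  forall i j, i \in S -> j \in S -> i != j -> A i j = 0.

(* A pair (S, m_S) is encoded with m_S extended by 0 outside S. *)
Definition ipair : Type := ({set 'I_n} * {ffun 'I_n -> nat})%type.

Definition Indep lambda : set ipair :=
  [set p : ipair |
    [/\ forall i, i \in p.1 -> in_J lambda i,
        independent p.1,
        forall i, i \in p.1 -> A i i <> 0 ->
          (p.2 i)%:R = 2 / (A i i)%:C%C * lambda (simple_coroot r i) + 1,
        forall i, i \in p.1 -> A i i = 0 -> (1 <= p.2 i)%N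
      & forall i, i \notin p.1 -> p.2 i = 0%N]]%classic.

(* The f_i, i in p.1, commute when p.1 is independent, so the order of the
   composition is immaterial. *)
Definition prod_f V (p : ipair) : V -> V :=
  \big[(fun f1 f2 => f1 \o f2)/id]_(i in p.1) iter (p.2 i) (act (bkm_f i)).

Definition holes lambda V : set ipair :=
  [set p : ipair | Indep lambda p /\
           forall v, weight_space V lambda v -> prod_f p v = 0]%classic.

Definition shifted lambda (p : ipair) : weight :=
  lambda - \sum_(i in p.1) simple_root r i *+ p.2 i.

Record local_JH V nu := LocalJH {
  jh_len : nat;
  jh_sub : nat -> submodule V;
  jh_bot : forall v, (v \in sub_mem (jh_sub 0)) = (v == 0);
  jh_top : forall v, v \in sub_mem (jh_sub jh_len);
  jh_incr : forall j, (j < jh_len)%N ->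
    {subset sub_mem (jh_sub j) <= sub_mem (jh_sub j.+1)};
  jh_factor : forall j, (j < jh_len)%N ->
    (exists eta, weight_le nu eta /\
       isomorphic (subquotient (jh_sub j.+1) (jh_sub j)) (simple_hw eta)) \/
    (forall eta, weight_le nu eta ->
       forall v, weight_space (subquotient (jh_sub j.+1) (jh_sub j)) eta v -> v = 0)
}.

Definition jh_occurs V nu (J : local_JH V nu) mu : Prop :=
  exists j : nat, [/\ (j < jh_len J)%N, weight_le nu mu
    & isomorphic (subquotient (jh_sub J j.+1) (jh_sub J j)) (simple_hw mu)].

End BKM.

Arguments weight_space {R n A r} V mu _.

(* Main.v *)
(** Call [x] singular of weight [lambda] if it is a weight vector killed by all
    [e_i]. For [(H, m)] in [Indep lambda] the vector [y = prod f_h^(m h) v_lambda]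
    is singular, so if it is nonzero then [L(lambda - sum m(h) alpha_h)] is a
    quotient of [U(g) y]: its weights are weights of [V], and it is the factor of
    any local Jordan-Hoelder series at the first step that contains [y].

    Conversely let [mu = lambda - sum c_i alpha_i] be a weight of [V]. Reflections
    in the real simple roots reduce to [mu(alpha_i^vee) >= 0] for real [i]. Such a
    [mu] is a weight of [L(lambda)] unless
    (a) [lambda(alpha_i^vee) = 0] on a union of connected components of [supp c], or
    (b) an imaginary [i] in [J_lambda] is isolated in [supp c] with [c_i >= m(i)].
    In both cases the word of [f]'s reaching [mu] can be rearranged so that it
    starts with [f_h^m] for an imaginary [h] such that [f_h^m v_lambda] is
    singular; one replaces [v_lambda] by that vector and iterates. The [h] so
    obtained are independent, because a neighbour of [h] in [supp c] gets a
    positive value at its coroot and hence leaves [J].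

    For the claim on [L(lambda)], apply first [prod f_i^(a_i)], where
    [a_i <= c_i] is maximal with [f_i^(a_i) v_lambda <> 0] in [L(lambda)], and
    let [gamma] be a maximal content with [a <= gamma <= c] and [lambda - gamma] a
    weight. If [gamma_i < c_i], then [f_i] kills the weight space; rank one theory
    and [gamma_i >= a_i] then force [gamma] to vanish at the neighbours of [i] if
    [i] is imaginary, and [(A gamma)_i >= 0 >= (A (c - gamma))_i] if [i] is real.
    Minimising [gamma_i / (c_i - gamma_i)] yields (a) or (b). *)

Require Import Defs.
From HB Require Import structures.
From mathcomp Require Import all_boot all_order all_algebra.
From mathcomp Require Import boolp classical_sets reals complex.
From mathcomp Require Import ring lra zify.

Set Implicit Arguments.
Unset Strict Implicit.
Unset Printing Implicit Defensive.

Import Order.TTheory GRing.Theory Num.Theory.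
Local Open Scope ring_scope.
Local Open Scope classical_set_scope.

(** * Rank one subalgebras *)

Section LieModuleTheory.
Variables (K : fieldType) (g : lieAlgebra K) (V : lieModule g).
Implicit Types (x y z : g) (v w : V).

Lemma act0l v : act 0 v = 0.
Proof. by rewrite -[0](scale0r 0) actZl scale0r. Qed.

Lemma actNl x v : act (- x) v = - act x v.
Proof. by rewrite -scaleN1r actZl scaleN1r. Qed.

Lemma act0r x : act x (0 : V) = 0.
Proof. by rewrite -[0 in LHS](scale0r 0) actZr scale0r. Qed.

Lemma act_sumr x (I : Type) (l : seq I) (P : pred I) (F : I -> V) :
  act x (\sum_(i <- l | P i) F i) = \sum_(i <- l | P i) act x (F i).
Proof. exact: (big_morph (act x) (actDr x) (act0r x)). Qed.

Lemma iter_act0 x k : iter k (act x) (0 : V) = 0.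
Proof. by elim: k => //= k ->; rewrite act0r. Qed.

Lemma iter_actZ x k c v : iter k (act x) (c *: v) = c *: iter k (act x) v.
Proof. by elim: k => //= k ->; rewrite actZr. Qed.

Lemma iter_actD x k v w :
  iter k (act x) (v + w) = iter k (act x) v + iter k (act x) w.
Proof. by elim: k => //= k ->; rewrite actDr. Qed.

Lemma iter_act_ge x k N v : (k <= N)%N ->
  iter k (act x) v = 0 -> iter N (act x) v = 0.
Proof. by move=> /subnK <- xk0; rewrite iterD xk0 iter_act0. Qed.

Lemma act_commute x y v : bracket x y = 0 -> act x (act y v) = act y (act x v).
Proof. by move=> xy; apply/subr0_eq; rewrite -act_bracket xy act0l. Qed.

Lemma act_iter_commute x y k v : bracket x y = 0 ->
  act x (iter k (act y) v) = iter k (act y) (act x v).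
Proof. by move=> xy; elim: k => //= k <-; rewrite act_commute. Qed.

Lemma bracket0r x : bracket x 0 = 0.
Proof. by rewrite -[0 in LHS](scale0r 0) bracketZr scale0r. Qed.

Lemma bracketNr x y : bracket x (- y) = - bracket x y.
Proof. by rewrite -scaleN1r bracketZr scaleN1r. Qed.

Lemma bracketC x y : bracket x y = - bracket y x.
Proof.
apply/eqP; rewrite -addr_eq0; apply/eqP.
by have := bracketxx (x + y); rewrite bracketDl !bracketDr !bracketxx add0r addr0.
Qed.

(* [x^(N+k) (z w)] is a sum of terms [ad_x^i z (x^(N+k-i) w)]. *)
Lemma nilpotent_act x z N k w :
  iter k (bracket x) z = 0 -> iter N (act x) w = 0 ->
  iter (N + k) (act x) (act z w) = 0.
Proof.
have [s] := ubnP (N + k)%N; elim: s N k z w => // s IHs [|N] [|k] z w.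
- by move=> _ _ /= ->; rewrite act0r.
- by move=> _ _ /= ->; rewrite act0r -iterS iter_act0.
- by move=> _ /= -> _; rewrite act0l -iterS iter_act0.
rewrite ltnS => leNk zk wN; rewrite addSn iterSr.
have -> : act x (act z w) = act (bracket x z) w + act z (act x w).
  by rewrite act_bracket subrK.
rewrite iter_actD addnS -addSn (IHs N.+1 k) ?add0r -?iterSr //; last by lia.
by rewrite addSnnS (IHs N k.+1) -?iterSr //; lia.
Qed.

(* A rank one subalgebra with [[h, e] = a e]; for [a = 0] it is a Heisenberg
   algebra. *)
Record rank_one (a : K) (e f h : g) : Prop := RankOne {
  bracket_ef : bracket e f = h;
  bracket_he : bracket h e = a *: e;
  bracket_hf : bracket h f = - a *: f
}.

Lemma rank_one_sym a e f h : rank_one a e f h -> rank_one a f e (- h).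
Proof.
case=> ef he hf; split; first by rewrite bracketC ef.
  by rewrite -scaleN1r bracketZl hf scalerA mulN1r opprK.
by rewrite -scaleN1r bracketZl he scalerA mulN1r.
Qed.

Section RankOne.
Variables (a : K) (e f h : g) (R1 : rank_one a e f h).

Lemma act_h_iter_f t k v :
  act h v = t *: v ->
  act h (iter k (act f) v) = (t - a *+ k) *: iter k (act f) v.
Proof.
move=> hv; elim: k => [|k IHk] /=; first by rewrite mulr0n subr0.
have -> : act h (act f (iter k (act f) v)) =
    act (bracket h f) (iter k (act f) v) + act f (act h (iter k (act f) v)).
  by rewrite act_bracket subrK.
rewrite (bracket_hf R1) IHk actZl actZr -scalerDl; congr (_ *: _).
by rewrite mulrS opprD addrCA addrC.
Qed.

(** Moving [e] through the [k+1] copies of [f] picks up the eigenvalues [t - a j] of [h] for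
    [j = 0, ..., k]; the scalar on the right is their sum. *)
Lemma act_e_iter_f t k v :
  act h v = t *: v ->
  act e (iter k.+1 (act f) v) =
    iter k.+1 (act f) (act e v)
      + (t *+ k.+1 - a *+ 'C(k.+1, 2)) *: iter k (act f) v.
Proof.
move=> hv; elim: k => [|k IHk].
  by rewrite /= bin_small // mulr0n subr0 mulr1n -hv -(bracket_ef R1) act_bracket addrC subrK.
rewrite iterS.
have -> u : act e (act f u) = act h u + act f (act e u).
  by rewrite -(bracket_ef R1) act_bracket subrK.
rewrite IHk (act_h_iter_f _ hv) actDr actZr addrCA -scalerDl; congr (_ + _ *: _).
by rewrite [in RHS]mulrSr [in RHS]binS bin1; ring.
Qed.

End RankOne.
End LieModuleTheory.

Section RankOneNum.
Variables (K : numFieldType) (g : lieAlgebra K) (V : lieModule g).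
Variables (a : K) (e f h : g) (R1 : rank_one a e f h).
Implicit Type v : V.

(** Twice the coefficient of [act_e_iter_f] factors as [(k+1)(2t - b k)]. *)
Lemma coef_eq0 (t b : K) k :
  (t *+ k.+1 - b *+ 'C(k.+1, 2) == 0) = (t *+ 2 == b *+ k).
Proof.
transitivity ((t *+ k.+1 - b *+ 'C(k.+1, 2)) *+ 2 == 0); first by rewrite mulrn_eq0.
have -> : (t *+ k.+1 - b *+ 'C(k.+1, 2)) *+ 2 = (t *+ 2 - b *+ k) *+ k.+1.
  rewrite mulrnBl -[b *+ _ *+ 2]mulrnA mulnC -mul_bin_diag bin1 mulnC.
  by rewrite mulrnBl -!mulrnA mulnC.
by rewrite mulrn_eq0 subr_eq0.
Qed.

Lemma act_e_iter_f0 t k v : act h v = t *: v -> act e v = 0 ->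
  t *+ 2 = a *+ k -> act e (iter k.+1 (act f) v) = 0.
Proof.
move=> hv ev /eqP; rewrite -coef_eq0 => /eqP c0.
by rewrite (act_e_iter_f R1 _ hv) ev iter_act0 c0 scale0r addr0.
Qed.

(** Raising from [f^(j+1) v] to [f^j v] costs a scalar that vanishes only if [2t = a j]. *)
Lemma iter_e_iter_f t k v : act h v = t *: v -> act e v = 0 ->
  (forall j, (j < k)%N -> t *+ 2 != a *+ j) ->
  exists2 c, c != 0 & iter k (act e) (iter k (act f) v) = c *: v.
Proof.
move=> hv ev; elim: k => [|k IHk] tP.
  by exists 1; rewrite ?oner_eq0 ?scale1r.
have [|c c0 cE] := IHk; first by move=> j jk; apply: tP; apply: ltnW.
exists ((t *+ k.+1 - a *+ 'C(k.+1, 2)) * c).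
  by rewrite mulf_neq0 // coef_eq0 tP.
rewrite iterSr (act_e_iter_f R1 _ hv) ev iter_act0 add0r iter_actZ cE.
by rewrite scalerA.
Qed.

(** Take [p] to be the last exponent with [e^p v] nonzero. For the exchanged triple [(f, e, -h)] the
    vector [v] has eigenvalue [-t] and is killed by the raising operator, so [f e^(p+1) v = 0]
    forces the coefficient of [e^p v] to vanish. *)
Lemma f_kernel_weight t N v : act h v = t *: v -> v <> 0 -> act f v = 0 ->
  iter N (act e) v = 0 ->
  exists p, [/\ (p < N)%N, iter p (act e) v <> 0, iter p.+1 (act e) v = 0
    & t *+ 2 = - (a *+ p)].
Proof.
move=> hv v0 fv; elim: N => [/v0[]|N IHN eN].
have [/IHN [p [pN ep ep1 tp]]|ep] := EM (iter N (act e) v = 0).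
  by exists p; split=> //; apply: ltnW.
exists N; split=> //.
have := act_e_iter_f (rank_one_sym R1) N (t := - t) (v := v).
rewrite actNl hv scaleNr fv eN act0r iter_act0 add0r => /(_ erefl) /esym/eqP.
rewrite scaler_eq0 coef_eq0 => /orP[|/eqP/ep[]].
by rewrite mulNrn eqr_oppLR => /eqP.
Qed.

End RankOneNum.

(** The formula for [e f^(k+2) v] shows that [f^(k+2)] kills [e v], which has eigenvalue [k+2].
    Induction on [N] gives [e v = 0], and then [e^k f^k v] is a nonzero multiple of [v]. *)
Lemma iter_f_inj (K : numFieldType) (g : lieAlgebra K) (V : lieModule g)
    (e f h : g) (v : V) N k :
  rank_one 2 e f h -> act h v = k%:R *: v -> iter N (act e) v = 0 ->
  iter k (act f) v = 0 -> v = 0.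
Proof.
move=> R1; elim: N k v => // N IHN k v hv eN fk.
have ev : act e v = 0.
  apply: (IHN k.+2); last 2 first.
  - by rewrite -iterSr.
  - have := act_e_iter_f R1 k.+1 hv.
    rewrite !iterS fk !act0r => /esym/eqP; rewrite scaler0 addr0 => /eqP.
    by rewrite -!iterS.
  have -> : act h (act e v) = act (bracket h e) v + act e (act h v).
    by rewrite act_bracket subrK.
  rewrite (bracket_he R1) hv actZl actZr -scalerDl; congr (_ *: _).
  by rewrite -natrD.
have [|c c0] := iter_e_iter_f R1 hv ev (k := k).
  by move=> j jk; rewrite -mulrnA -mulrnA eqr_nat mulnC eqn_mul2l/= gtn_eqF.
rewrite fk iter_act0 => /esym/eqP.
by rewrite scaler_eq0 (negPf c0) => /eqP.
Qed.

(** * Weights *)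

Section WeightTheory.
Variables (R : realType) (n : nat) (A : 'M[R]_n) (r : realization A).
Notation K := R[i].
Notation E := (bkm_e r).
Notation F := (bkm_f r).
Notation alpha := (simple_root r).
Implicit Types (lambda mu nu eta : weight r) (V : lieModule (bkm r)).

Lemma bkm_rank_one i : rank_one (A i i)%:C%C (E i) (F i) (bkm_h (simple_coroot r i)).
Proof.
split; rewrite ?[LHS]lie_brE.
- by apply/lqP; apply: lw_rel; have := rel_EF r i i; rewrite eqxx.
- rewrite -(simple_root_coroot r i i) [RHS]lie_classZ.
  by apply/lqP; apply: lw_rel; apply: rel_HE.
- rewrite -(simple_root_coroot r i i) [RHS]lie_classZ.
  by apply/lqP; apply: lw_rel; apply: rel_HF.
Qed.

Lemma bracket_EF i j : i != j -> bracket (E i) (F j) = 0.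
Proof.
move=> ij; rewrite [LHS]lie_brE; apply/lqP/lw_rel.
by have := rel_EF r i j; rewrite (negPf ij).
Qed.

Lemma bracket_FF i j : A i j = 0 -> bracket (F i) (F j) = 0.
Proof. by move=> ij; rewrite [LHS]lie_brE; apply/lqP/lw_rel/rel_FF. Qed.

Lemma serre_F i j (k : nat) : A i i = 2 -> j != i -> A i j = - k%:R ->
  iter k.+1 (bracket (F i)) (F j) = 0.
Proof.
move=> Ai ij Aij; rewrite -[RHS](lq0 (lie_pre (bkm_rel (r := r)))).
transitivity (lie_class (bkm_rel (r := r))
    (iter k.+1 (LBr (LGen (GF r i))) (LGen (GF r j)))).
  by elim: k.+1 => [//|m IHm]; rewrite !iterS IHm [LHS]lie_brE.
exact/lqP/lw_rel/rel_serreF.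
Qed.

(** A submodule as a predicate. Closure is asked only for the Chevalley generators; [stable_act]
    extends it to the whole Lie algebra by induction on Lie words. *)
Definition stable V (P : V -> Prop) : Prop :=
  [/\ P 0, forall c v w, P v -> P w -> P (c *: v + w),
      forall h v, P v -> P (act (bkm_h h) v),
      forall i v, P v -> P (act (E i) v)
    & forall i v, P v -> P (act (F i) v)].

Section Stable.
Variables (V : lieModule (bkm r)) (P : V -> Prop) (sP : stable P).

Lemma stableZ c v : P v -> P (c *: v).
Proof. by case: sP => P0 PD _ _ _ Pv; rewrite -[_ *: _]addr0; apply: PD. Qed.

Lemma stableD v w : P v -> P w -> P (v + w).
Proof. by case: sP => _ PD _ _ _ Pv Pw; rewrite -[v]scale1r; apply: PD. Qed.

Lemma stableB v w : P v -> P w -> P (v - w).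
Proof. by move=> Pv Pw; rewrite -scaleN1r; apply: stableD => //; apply: stableZ. Qed.

Lemma stable_act x v : P v -> P (act x v).
Proof.
have [P0 _ Ph Pe Pf] := sP.
case: (lie_classP x) => {}x ->.
elim: x v => [[h|i|i]||x IHx y IHy|c x IHx|x IHx y IHy] v Pv.
- exact: Ph.
- exact: Pe.
- exact: Pf.
- by rewrite [lie_class _ _]lq0 act0l.
- by rewrite -lie_classD actDl; apply: stableD; [apply: IHx | apply: IHy].
- by rewrite -lie_classZ actZl; apply/stableZ/IHx.
- have -> : lie_class (bkm_rel (r := r)) (LBr x y) =
      bracket (lie_class (bkm_rel (r := r)) x : bkm r) (lie_class (bkm_rel (r := r)) y).
    by rewrite /= lie_brE.
  by rewrite act_bracket; apply: stableB; [apply/IHx/IHy | apply/IHy/IHx].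
Qed.

Lemma stable_submodule : exists N : submodule V, forall v : V, v \in Defs.sub_mem N <-> P v.
Proof.
have [P0 PD _ _ _] := sP.
have Pc : submod_closed (fun v : V => `[< P v >] : bool).
  split; first by rewrite unfold_in; apply/asboolP.
  move=> c v w; rewrite !unfold_in => /asboolP Pv /asboolP Pw; apply/asboolP.
  exact: PD.
have Pa x (v : V) : v \in (fun v : V => `[< P v >] : bool) ->
    act x v \in (fun v : V => `[< P v >] : bool).
  by rewrite !unfold_in => /asboolP Pv; apply/asboolP/stable_act.
by exists (Submodule Pc Pa) => v; split=> /asboolP.
Qed.

End Stable.

Lemma submodule_stable V (N : submodule V) : stable (fun v : V => v \in Defs.sub_mem N).
Proof.
have [N0 ND] := sub_closed N.
by split=> // *; try (exact: ND); exact: sub_act.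
Qed.

Lemma weight_spaceZ V mu c v : weight_space V mu v -> weight_space V mu (c *: v).
Proof. by move=> vP h; rewrite actZr vP !scalerA mulrC. Qed.

Lemma bracket_HE h i : bracket (bkm_h h) (E i) = alpha i h *: E i :> bkm r.
Proof.
by rewrite [LHS]lie_brE [RHS]lie_classZ; apply/lqP/lw_rel/rel_HE.
Qed.

Lemma bracket_HF h i : bracket (bkm_h h) (F i) = - alpha i h *: F i :> bkm r.
Proof.
by rewrite [LHS]lie_brE [RHS]lie_classZ; apply/lqP/lw_rel/rel_HF.
Qed.

Lemma weight_space_e V mu i v : weight_space V mu v ->
  weight_space V (mu + alpha i) (act (E i) v).
Proof.
move=> vP h; have -> : act (bkm_h h) (act (E i) v) =
    act (bracket (bkm_h h) (E i)) v + act (E i) (act (bkm_h h) v).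
  by rewrite act_bracket subrK.
by rewrite bracket_HE vP actZl actZr -scalerDl add_lfunE addrC.
Qed.

Lemma weight_space_f V mu i v : weight_space V mu v ->
  weight_space V (mu - alpha i) (act (F i) v).
Proof.
move=> vP h; have -> : act (bkm_h h) (act (F i) v) =
    act (bracket (bkm_h h) (F i)) v + act (F i) (act (bkm_h h) v).
  by rewrite act_bracket subrK.
by rewrite bracket_HF vP actZl actZr -scalerDl add_lfunE opp_lfunE addrC.
Qed.

Lemma weight_space_iter_e V mu i k v : weight_space V mu v ->
  weight_space V (mu + alpha i *+ k) (iter k (act (E i)) v).
Proof.
move=> vP; elim: k => [|k IHk]; first by rewrite mulr0n addr0.
by rewrite iterS mulrSr addrA; apply: weight_space_e.
Qed.

Lemma weight_space_iter_f V mu i k v : weight_space V mu v ->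
  weight_space V (mu - alpha i *+ k) (iter k (act (F i)) v).
Proof.
move=> vP; elim: k => [|k IHk]; first by rewrite mulr0n subr0.
by rewrite iterS mulrSr opprD addrA; apply: weight_space_f.
Qed.

End WeightTheory.

(** * Words in the lowering operators *)

Section Words.
Variables (R : realType) (n : nat) (A : 'M[R]_n) (r : realization A).
Notation K := R[i].
Notation E := (bkm_e r).
Notation F := (bkm_f r).
Notation alpha := (simple_root r).
Implicit Types (lambda mu nu eta : weight r) (V : lieModule (bkm r)) (s : seq 'I_n).

Section Projection.
Variables (V : lieModule (bkm r)) (P : V -> Prop) (sP : stable P).
Variables (I : Type) (w : I -> V).

(** Lagrange interpolation in inductive form: [h - t0] kills the terms of eigenvalue [t0] and
    rescales the others by nonzero factors, which the coefficient function can absorb. *)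
Lemma stable_eigen (h : bkm r) (t : I -> K) (l : seq I) (b : K -> K) :
  (forall k, act h (w k) = t k *: w k) ->
  P (\sum_(k <- l) w k) -> P (\sum_(k <- l) b (t k) *: w k).
Proof.
move=> wt; have [m] := ubnP (size l).
elim: m l b (w) wt => // m IHm [|k0 l] b u ut lt_m Pl; first by rewrite big_nil; case: sP.
set L := k0 :: l in lt_m Pl *; set t0 := t k0.
set L' := [seq k <- L | t k != t0].
have L'b c : P (\sum_(k <- L') c (t k) *: u k).
  have -> : \sum_(k <- L') c (t k) *: u k =
      \sum_(k <- L') (c (t k) / (t k - t0)) *: ((t k - t0) *: u k).
    rewrite [LHS]big_filter [RHS]big_filter; apply: eq_bigr => k tk.
    by rewrite scalerA divfK // subr_eq0.
  apply: (IHm L' (fun z => c z / (z - t0)) (fun k => (t k - t0) *: u k)).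
  - by move=> k; rewrite actZr ut !scalerA mulrC.
  - rewrite /L' /L /= eqxx size_filter.
    by apply: leq_ltn_trans (count_size _ _) _; rewrite -ltnS.
  rewrite [X in P X](_ : _ = act h (\sum_(k <- L) u k) - t0 *: (\sum_(k <- L) u k)).
    by apply: (stableB sP); [apply: stable_act | apply: stableZ].
  rewrite act_sumr scaler_sumr -sumrB [LHS]big_filter.
  rewrite [RHS](bigID (fun k => t k != t0)) /= [X in _ + X]big1 ?addr0.
    by apply: eq_bigr => k _; rewrite ut scalerBl.
  by move=> k /negPn/eqP tk; rewrite ut tk subrr.
(* The terms of eigenvalue [t0] are the whole sum minus the sum over [L'], the case of the constant
   coefficient 1. *)
have -> : \sum_(k <- L) b (t k) *: u k = \sum_(k <- L') b (t k) *: u k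
    + b t0 *: (\sum_(k <- L) u k - \sum_(k <- L') 1 *: u k).
  rewrite [LHS](bigID (fun k => t k != t0)) /= [in RHS]big_filter; congr (_ + _).
  rewrite [X in _ *: (X - _)](bigID (fun k => t k != t0)) /= [in RHS]big_filter.
  under [X in _ *: (_ - X)]eq_bigr do rewrite scale1r.
  rewrite [X in _ *: (X - _)]addrC addrK scaler_sumr.
  by apply: eq_bigr => k /negPn/eqP ->.
apply: (stableD sP); first exact: L'b.
apply: (stableZ sP); apply: (stableB sP) => //.
exact: (L'b (fun _ => 1)).
Qed.

(** With the indicator of [mu h] as coefficient, [stable_eigen] selects the right eigenvalue of one
    [h]; running through a basis of the Cartan subalgebra isolates the weight [mu]. *)
Lemma stable_weight (wg : I -> weight r) (l : seq I) mu :
  (forall k, weight_space V (wg k) (w k)) ->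
  P (\sum_(k <- l) w k) -> P (\sum_(k <- l | wg k == mu) w k).
Proof.
move=> wP Pl.
have Pall (hs : seq r) : P (\sum_(k <- l | all (fun h => wg k h == mu h) hs) w k).
  elim: hs => [|h hs IHhs] //=.
  rewrite -big_filter in IHhs.
  have /= := stable_eigen (h := bkm_h h) (t := fun k => wg k h)
    (fun z => (z == mu h)%:R) (wP^~ h) IHhs.
  rewrite [X in P X](_ : _ = \sum_(k <- l |
    (wg k h == mu h) && all (fun h => wg k h == mu h) hs) w k) //.
  rewrite big_filter [RHS]big_mkcondl; apply: eq_bigr => k _.
  by case: eqP; rewrite ?scale1r ?scale0r.
rewrite (eq_bigl (fun k => all (fun h => wg k h == mu h) (vbasis {: r})%VS)) //.
move=> k; apply/eqP/allP => [-> //|eqb].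
apply/lfunP => h; rewrite (coord_vbasis (memvf h)) !linear_sum; apply: eq_bigr => i _.
by rewrite !linearZ /=; congr (_ *: _); apply/eqP/eqb/mem_nth; rewrite size_tuple.
Qed.

End Projection.

Lemma simple_root_lin_free (a : 'I_n -> K) :
  \sum_i a i *: alpha i = 0 -> forall i, a i = 0.
Proof.
move=> a0; have fa : free [tuple of [seq alpha i | i <- ord_tuple n]].
  by have := simple_root_free r; rewrite -val_ord_tuple.
apply: (freeP fa); rewrite -[RHS]a0; apply: eq_bigr => i _.
by rewrite -tnth_nth tnth_map tnth_ord_tuple.
Qed.

Definition fword V s (x : V) : V := foldr (fun i => act (F i)) x s.
Definition root_sum s : weight r := \sum_(i <- s) alpha i.

Lemma root_sum_cons i s : root_sum (i :: s) = alpha i + root_sum s.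
Proof. exact: big_cons. Qed.

Lemma root_sum_cat s s' : root_sum (s ++ s') = root_sum s + root_sum s'.
Proof. exact: big_cat. Qed.

Lemma root_sum_nseq k i : root_sum (nseq k i) = alpha i *+ k.
Proof. by rewrite /root_sum big_nseq -Monoid.iteropE. Qed.

Lemma root_sum_count s : root_sum s = \sum_i alpha i *+ count_mem i s.
Proof.
elim: s => [|j s IHs].
  by rewrite /root_sum big_nil big1 // => i _; rewrite mulr0n.
rewrite root_sum_cons IHs /=.
under [RHS]eq_bigr do rewrite mulrnDr.
rewrite big_split /=; congr (_ + _).
rewrite (bigD1 j) //= eqxx mulr1n big1 ?addr0 // => i /negPf.
by rewrite eq_sym => ->; rewrite mulr0n.
Qed.

Lemma simple_root_inj (c d : 'I_n -> nat) :
  \sum_i alpha i *+ c i = \sum_i alpha i *+ d i -> c =1 d.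
Proof.
move=> cd i; apply/eqP; rewrite -(eqr_nat K) -subr_eq0; apply/eqP.
apply: (simple_root_lin_free (a := fun i => (c i)%:R - (d i)%:R)) i.
under eq_bigr do rewrite scalerBl !scaler_nat.
by rewrite sumrB cd subrr.
Qed.

Lemma root_sum_inj s s' : root_sum s = root_sum s' -> perm_eq s s'.
Proof.
by rewrite !root_sum_count => /simple_root_inj cE; apply/allP => i _; apply/eqP/cE.
Qed.

Lemma root_sum_eq0 s : root_sum s = 0 -> s = [::].
Proof.
have -> : 0 = root_sum [::] by rewrite /root_sum big_nil.
by move/root_sum_inj/perm_nilP.
Qed.

Lemma fword_cat V s s' (x : V) : fword (s ++ s') x = fword s (fword s' x).
Proof. exact: foldr_cat. Qed.

Lemma fword_nseq V k i (x : V) : fword (nseq k i) x = iter k (act (F i)) x.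
Proof. by elim: k => //= k ->. Qed.

Lemma fword0 V s : fword s (0 : V) = 0.
Proof. by elim: s => //= i s ->; rewrite act0r. Qed.

Lemma fwordZ V s c (x : V) : fword s (c *: x) = c *: fword s x.
Proof. by elim: s => //= i s ->; rewrite actZr. Qed.

Lemma weight_space_fword V mu s (x : V) : weight_space V mu x ->
  weight_space V (mu - root_sum s) (fword s x).
Proof.
move=> xP; elim: s => [|i s IHs] /=; first by rewrite /root_sum big_nil subr0.
by rewrite root_sum_cons [alpha i + _]addrC opprD addrA; apply: weight_space_f.
Qed.

Definition singular V lambda (x : V) : Prop :=
  weight_space V lambda x /\ forall i, act (E i) x = 0.

(** This is [U(n^-) x]; for singular [x] it is all of [U(g) x], by [fspan_stable]. *)
Definition fspan V (x w : V) : Prop :=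
  exists l : seq (K * seq 'I_n), w = \sum_(p <- l) p.1 *: fword p.2 x.

Lemma fspan_fword V s (x : V) : fspan x (fword s x).
Proof. by exists [:: (1, s)]; rewrite big_seq1 scale1r. Qed.

Lemma fspan_lin V c (x v w : V) : fspan x v -> fspan x w -> fspan x (c *: v + w).
Proof.
move=> [l ->] [m ->]; exists ([seq (c * p.1, p.2) | p <- l] ++ m).
rewrite big_cat big_map scaler_sumr /=; congr (_ + _).
by apply: eq_bigr => p _; rewrite scalerA.
Qed.

Lemma fspan0 V (x : V) : fspan x 0.
Proof. by exists [::]; rewrite big_nil. Qed.

Lemma fspanZ V c (x v : V) : fspan x v -> fspan x (c *: v).
Proof. by move=> xv; rewrite -[_ *: _]addr0; apply/fspan_lin/fspan0. Qed.

Lemma fspanD V (x v w : V) : fspan x v -> fspan x w -> fspan x (v + w).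
Proof. by move=> xv xw; rewrite -[v]scale1r; apply: fspan_lin. Qed.

Lemma fspan_sum V (x : V) (I : Type) (l : seq I) (G : I -> V) :
  (forall i, fspan x (G i)) -> fspan x (\sum_(i <- l) G i).
Proof. by move=> xG; apply: big_ind => //; [apply: fspan0 | apply: fspanD]. Qed.

Lemma fspan_f V i (x w : V) : fspan x w -> fspan x (act (F i) w).
Proof.
move=> [l ->]; rewrite act_sumr; apply: fspan_sum => p.
by rewrite actZr; apply/fspanZ/(fspan_fword (i :: p.2)).
Qed.

(** Each [e_i] is commuted through the [f_j] until it reaches [x]; the commutators are zero or lie
    in the Cartan subalgebra, which acts on words by scalars. *)
Lemma fspan_stable V lambda (x : V) : singular lambda x -> stable (fspan x).
Proof.
move=> [xl xe]; split.
- exact: fspan0.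
- by move=> *; apply: fspan_lin.
- move=> h w [l ->]; rewrite act_sumr; apply: fspan_sum => p.
  rewrite actZr (weight_space_fword _ xl).
  exact/fspanZ/fspanZ/fspan_fword.
- move=> i w [l ->]; rewrite act_sumr; apply: fspan_sum => p.
  rewrite actZr; apply: fspanZ; elim: p.2 => [|j s IHs] /=.
    by rewrite xe; apply: fspan0.
  have -> u : act (E i) (act (F j) u) = act (bracket (E i) (F j)) u + act (F j) (act (E i) u).
    by rewrite act_bracket subrK.
  apply: fspanD; last exact: fspan_f.
  have [<-|/bracket_EF ->] := eqVneq i j; last by rewrite act0l; apply: fspan0.
  rewrite (bracket_ef (bkm_rank_one r i)) (weight_space_fword _ xl).
  exact/fspanZ/fspan_fword.
- by move=> *; apply: fspan_f.
Qed.

(** [V = U(g) x], phrased as an induction principle. *)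
Definition generated V (x : V) : Prop :=
  forall P : V -> Prop, stable P -> P x -> forall w, P w.

Lemma generated_fspan V lambda (x w : V) :
  generated x -> singular lambda x -> fspan x w.
Proof. by move=> gx sx; apply: gx (fspan_stable sx) (fspan_fword [::] x) w. Qed.

Lemma stable_eq0 V : stable (fun w : V => w = 0).
Proof.
by split=> // [c v w -> ->|h v ->|i v ->|i v ->]; rewrite ?scaler0 ?addr0 ?act0r.
Qed.

Lemma fspan_component V lambda mu (x : V) (P : V -> Prop)
    (l : seq (K * seq 'I_n)) :
  weight_space V lambda x -> stable P ->
  P (\sum_(p <- l) p.1 *: fword p.2 x) ->
  P (\sum_(p <- l | lambda - root_sum p.2 == mu) p.1 *: fword p.2 x).
Proof.
move=> xl sP; apply: (stable_weight sP (wg := fun p => lambda - root_sum p.2)).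
by move=> p; apply/weight_spaceZ/weight_space_fword.
Qed.

Lemma fspan_weight V lambda mu (x w : V) :
  weight_space V lambda x -> weight_space V mu w -> fspan x w -> w <> 0 ->
  exists2 s, fword s x <> 0 & mu = lambda - root_sum s.
Proof.
move=> xl wm [l wE] w0.
(* The summand [None] is [-w], so the family sums to zero, and so does its component of weight [mu].
   If every word of that weight killed [x], only [-w] would be left there. *)
have := @stable_weight V (fun u => u = 0) (stable_eq0 V) _
  (fun p : option (K * seq 'I_n) =>
     if p is Some p then p.1 *: fword p.2 x else - w)
  (fun p => if p is Some p then lambda - root_sum p.2 else mu)
  (None :: map some l) mu.
rewrite !big_cons !big_map eqxx -wE addNr => sE.
apply: contrapT => nex; apply: w0; apply/eqP; rewrite -oppr_eq0; apply/eqP.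
rewrite -[LHS]addr0 -[RHS]sE //; last first.
  case=> [p|]; first exact/weight_spaceZ/weight_space_fword.
  by rewrite -scaleN1r; apply: weight_spaceZ.
congr (_ + _); rewrite big1 // => p /eqP pE.
have [->|fp] := EM (fword p.2 x = 0); first by rewrite scaler0.
by case: nex; exists p.2.
Qed.

End Words.

Arguments root_sum {R n A r} s.

(** * Verma modules and their simple quotients *)

Section Quotients.
Variables (K : fieldType) (g : lieAlgebra K) (M : lieModule g) (N : submodule M).

Lemma quot_class_eq0 (v : M) :
  (quot_class N v : quot_module N) = 0 <-> v \in Defs.sub_mem N.
Proof.
rewrite -[v in v \in _]subr0.
exact: (lqP (P := quot_pre N) v (0 : M)).
Qed.

Lemma act_quot_class x (v : M) :
  act x (quot_class N v : quot_module N) = quot_class N (act x v).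
Proof. exact: quot_actE. Qed.

Lemma quot_class_lin c (v w : M) :
  quot_class N (c *: v + w) = c *: (quot_class N v : quot_module N) + quot_class N w.
Proof. by rewrite [in RHS]quot_classZ [RHS]quot_classD. Qed.

End Quotients.

Section HighestWeight.
Variables (R : realType) (n : nat) (A : 'M[R]_n) (r : realization A).
Notation K := R[i].
Notation E := (bkm_e r).
Notation F := (bkm_f r).
Notation alpha := (simple_root r).
Implicit Types (lambda mu nu eta : weight r) (V : lieModule (bkm r)) (s : seq 'I_n).

(** Bare functions, so that quotient classes and evaluations of words qualify without a bundled
    linear structure. *)
Definition module_morph (V W : lieModule (bkm r)) (f : V -> W) : Prop :=
  (forall c v w, f (c *: v + w) = c *: f v + f w) /\
  forall x v, f (act x v) = act x (f v).

Section Morph.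
Variables (V W : lieModule (bkm r)) (f : V -> W) (mf : module_morph f).

Lemma morph0 : f 0 = 0.
Proof.
have [fl _] := mf; have := fl (-1) 0 0.
by rewrite scaler0 addr0 scaleN1r addNr.
Qed.

Lemma morphZ c v : f (c *: v) = c *: f v.
Proof. by have [fl _] := mf; rewrite -[_ *: v]addr0 fl morph0 addr0. Qed.

Lemma morph_fword s v : f (fword s v) = fword s (f v).
Proof. by have [_ fa] := mf; elim: s => //= i s <-; rewrite fa. Qed.

Lemma morph_weight mu v : weight_space V mu v -> weight_space W mu (f v).
Proof. by have [_ fa] := mf; move=> vm h; rewrite -fa vm morphZ. Qed.

Lemma morph_singular mu v : singular mu v -> singular mu (f v).
Proof.
have [_ fa] := mf; case=> vm ve; split; first exact: morph_weight.
by move=> i; rewrite -fa ve morph0.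
Qed.

Lemma stable_preim (P : W -> Prop) : stable P -> stable (fun v => P (f v)).
Proof.
have [fl fa] := mf; case=> P0 PD Ph Pe Pf; split.
- by rewrite morph0.
- by move=> c v w Pv Pw; rewrite fl; apply: PD.
- by move=> h v Pv; rewrite fa; apply: Ph.
- by move=> i v Pv; rewrite fa; apply: Pe.
- by move=> i v Pv; rewrite fa; apply: Pf.
Qed.

Lemma generated_morph v : (forall w, exists v, f v = w) ->
  generated v -> generated (f v).
Proof.
move=> fs gv P sP Pv w; have [u <-] := fs w.
exact: (gv _ (stable_preim sP)).
Qed.

End Morph.

Lemma quot_class_morph V (N : submodule V) :
  @module_morph V (quot_module N) (quot_class N).
Proof.
by split=> [c v w|x v]; [apply: quot_class_lin | rewrite act_quot_class].
Qed.

Definition verma_gen lambda : verma lambda := mod_class (verma_rel lambda) (MGen _).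

Lemma verma_singular lambda : singular lambda (verma_gen lambda).
Proof.
split=> [h|i]; rewrite [act _ _]mod_actE.
  by rewrite [RHS]mod_classZ; apply/lqP; apply: mw_rel; apply: verma_H.
by apply/lqP; apply: mw_rel; apply: verma_E.
Qed.

Lemma verma_generated lambda : generated (verma_gen lambda).
Proof.
move=> P sP Pg w; case: (mod_classP w) => {}w ->.
elim: w => [//||v IHv w IHw|c v IHv|x v IHv].
- by case: sP.
- by rewrite -mod_classD; apply: (stableD sP).
- by rewrite -mod_classZ; apply: (stableZ sP).
- by rewrite -mod_actE; apply: (stable_act sP).
Qed.

Arguments verma_generated : clear implicits.

(** Module words are evaluated in [V] at [x]. Evaluation respects the congruence: the module laws
    hold in [V], and the Verma relations hold because [x] is singular. *)
Lemma verma_universal lambda V (x : V) : singular lambda x ->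
  exists2 f : verma lambda -> V, module_morph f & f (verma_gen lambda) = x.
Proof.
move=> [xl xe].
pose fix ev (w : mod_word (bkm r)) : V := match w with
  | MGen => x | MZero => 0 | MAdd v w => ev v + ev w
  | MScale c w => c *: ev w | MAct a w => act a (ev w) end.
have evP v w : mod_eq (verma_rel lambda) v w -> ev v = ev w.
  elim=> {v w} //=.
  - by move=> _ _ [].
  - by move=> ? ? ? _ -> _ ->.
  - by move=> ? ? ? ? _ -> _ ->.
  - by move=> ? ? ? _ ->.
  - by move=> ? ? ? _ ->.
  - by move=> *; rewrite addrA.
  - by move=> *; rewrite addrC.
  - by move=> *; rewrite add0r.
  - by move=> ?; rewrite scaleN1r addNr.
  - by move=> *; rewrite scalerA.
  - by move=> *; rewrite scale1r.
  - by move=> *; rewrite scalerDr.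
  - by move=> *; rewrite scalerDl.
  - by move=> *; rewrite actDl.
  - by move=> *; rewrite actDr.
  - by move=> *; rewrite actZl.
  - by move=> *; rewrite actZr.
  - by move=> *; rewrite act_bracket scaleN1r.
pose f (q : verma lambda) := ev (lrepr q).
have fE w : f (mod_class (verma_rel lambda) w) = ev w.
  exact/evP/(lrepr_lq (P := mod_pre (verma_rel lambda))).
exists f; last exact: fE.
split=> [c v w|a v].
  case: (mod_classP v) (mod_classP w) => {}v -> [{}w ->].
  by rewrite mod_classZ mod_classD !fE.
by case: (mod_classP v) => {}v ->; rewrite [act _ _]mod_actE !fE.
Qed.

Lemma quotient_singular lambda V : quotient_of (verma lambda) V ->
  exists2 x : V, singular lambda x & generated x.
Proof.
case=> f [fh fs].
have mf : module_morph f by split=> *; [rewrite linearP | rewrite fh].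
exists (f (verma_gen lambda)).
  exact: (morph_singular mf (verma_singular _)).
exact: (generated_morph mf fs (verma_generated _)).
Qed.

Lemma generated_not_proper V (x : V) (N : submodule V) :
  generated x -> proper_submodule N -> x \notin Defs.sub_mem N.
Proof.
move=> gx [v vN]; apply: contra vN => xN.
exact: (gx _ (submodule_stable N) xN).
Qed.

Lemma proper_sub_rad V (N : submodule V) (v : V) :
  proper_submodule N -> v \in Defs.sub_mem N -> v \in Defs.sub_mem (sum_proper V).
Proof.
by move=> pN vN; apply/asboolP => N' /(_ _ pN) /(_ v vN).
Qed.

(** For a weight vector [x], the part of [U(n^-) x] of weights strictly below that of [x]. *)
Definition lower_span V (x w : V) : Prop :=
  exists2 l : seq (K * seq 'I_n),
    w = \sum_(p <- l) p.1 *: fword p.2 x & all (fun p => p.2 != [::]) l.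

Lemma lower_span_lin V c (x v w : V) :
  lower_span x v -> lower_span x w -> lower_span x (c *: v + w).
Proof.
move=> [l -> ln] [m -> mn]; exists ([seq (c * p.1, p.2) | p <- l] ++ m).
  rewrite big_cat big_map scaler_sumr /=; congr (_ + _).
  by apply: eq_bigr => p _; rewrite scalerA.
by rewrite all_cat all_map mn andbT.
Qed.

(** Only the empty word has root sum zero, so in such a relation the component of weight [lambda] is
    [x] alone. *)
Lemma lower_spanN lambda V (x : V) : singular lambda x -> x <> 0 -> ~ lower_span x x.
Proof.
move=> [xl _] x0 [l xE ln]; apply: x0.
have := fspan_component (l := (-1, [::]) :: l) lambda xl (stable_eq0 V).
rewrite !big_cons /= -xE scaleN1r addNr => /(_ erefl).
rewrite {1}/root_sum big_nil subr0 eqxx big1_seq ?addr0 => [/eqP|p].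
  by rewrite oppr_eq0 => /eqP.
rewrite eq_sym -subr_eq0 opprB addrC subrK => /andP[/eqP/root_sum_eq0 p0 pl].
by have /allP/(_ _ pl) := ln; rewrite p0.
Qed.

(* The vectors none of whose images under [U(g)] has a component along the
   highest weight vector [x] form a submodule that contains all proper ones. *)
Lemma gen_notin_rad lambda V (x : V) : generated x -> singular lambda x -> x <> 0 ->
  x \notin Defs.sub_mem (sum_proper V).
Proof.
move=> gx sx x0; have [xl _] := sx.
(* Quantifying over all products of elements of the Lie algebra makes [P] stable under the action by
   construction. *)
pose P (u : V) := forall l : seq (bkm r), lower_span x (foldr (fun a => act a) u l).
have sP : stable P.
  have Pact a u : P u -> P (act a u).
    by move=> Pu l; have := Pu (rcons l a); rewrite foldr_rcons.
  split=> [l|c v w Pv Pw l||i|i]; try by move=> *; apply: Pact.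
    exists [::] => //; rewrite big_nil.
    by elim: l => //= a l ->; rewrite act0r.
  have -> : foldr (fun a => act a) (c *: v + w) l =
      c *: foldr (fun a => act a) v l + foldr (fun a => act a) w l.
    by elim: l => //= a l ->; rewrite actDr actZr.
  exact: lower_span_lin.
have [N NP] := stable_submodule sP.
apply/negP => /asboolP/(_ N) xN; apply: (lower_spanN sx x0).
apply: (proj1 (NP x) (xN _) [::]).
move=> N' pN' u uN'; apply/NP => l.
have : foldr (fun a => act a) u l \in Defs.sub_mem N'.
  by elim: l => //= a l IHl; apply: sub_act.
move: (foldr _ u l) => w wN'; have [m wE] := generated_fspan w gx sx.
(* The component of [w] of weight [lambda] lies in [N'] and is a multiple of [x]; as [N'] is proper,
   the multiple is zero. *)
have := fspan_component (l := m) lambda xl (submodule_stable N').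
rewrite -wE => /(_ wN').
have lE s : (lambda - root_sum s == lambda) = (s == [::]).
  apply/eqP/eqP => [|->]; last by rewrite /root_sum big_nil subr0.
  by move/eqP; rewrite subr_eq addrC -subr_eq subrr eq_sym => /eqP/root_sum_eq0.
rewrite (eq_bigl (fun p => p.2 == [::])) => [|p]; last exact: lE.
rewrite (eq_bigr (fun p => p.1 *: x)) => [|p /eqP -> //].
rewrite -scaler_suml; set c := \sum_(p <- m | _) _ => cN'.
have c0 : c = 0.
  apply/eqP/negPn/negP => c0.
  have /negP := generated_not_proper gx pN'; apply.
  rewrite -[x]scale1r -(mulVf c0) -scalerA.
  exact: (stableZ (submodule_stable N')).
exists [seq p <- m | p.2 != [::]]; last exact: filter_all.
rewrite big_filter wE (bigID (fun p => p.2 == [::])) /=.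
rewrite [X in X + _](eq_bigr (fun p => p.1 *: x)) => [|p /eqP -> //].
by rewrite -scaler_suml -/c c0 scale0r add0r.
Qed.

(** Irreducibility enters through the weights of singular vectors, the form that identifies
    Jordan-Hölder factors. *)
Record irreducible_hw V lambda (x : V) : Prop := IrreducibleHW {
  irr_generated : generated x;
  irr_singular : singular lambda x;
  irr_simple : forall mu (y : V), singular mu y -> y <> 0 -> mu = lambda
}.

Definition simple_gen lambda : simple_hw lambda := quot_class _ (verma_gen lambda).

(** A nonzero singular [y] generates the highest weight vector: otherwise the preimage of [U(g) y]
    in the Verma module is proper, hence inside the radical, and [y = 0]. *)
Lemma simple_irreducible lambda : irreducible_hw lambda (simple_gen lambda).
Proof.
have mq := quot_class_morph (sum_proper (verma lambda)).
have sL := morph_singular mq (verma_singular lambda).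
have gL : generated (simple_gen lambda).
  apply: (generated_morph mq) (verma_generated lambda) => w.
  by case: (quot_classP w) => v ->; exists v.
split=> // mu y sy y0; have [ym _] := sy; have [Ll _] := sL.
have Ly : fspan y (simple_gen lambda).
  have [u yE] := quot_classP y.
  have [N NP] := stable_submodule (stable_preim mq (fspan_stable sy)).
  apply/NP/negPn/negP => gN; apply: y0; rewrite yE; apply/quot_class_eq0.
  apply: (@proper_sub_rad _ N); first by exists (verma_gen lambda).
  by apply/NP; rewrite -yE; apply: (fspan_fword [::]).
have [s ys muE] := fspan_weight Ll ym (generated_fspan y gL sL) y0.
have L0 : simple_gen lambda <> 0.
  by move=> L0; apply: ys; rewrite -/(simple_gen lambda) L0 fword0.
have [s' _ lE] := fspan_weight ym Ll Ly L0.
(* [mu] is below [lambda] by [s], and [lambda] below [mu] by [s'], so both words are empty. *)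
have : root_sum (s ++ s') = 0 :> weight r.
  rewrite root_sum_cat; apply/eqP; rewrite -oppr_eq0 opprD -(inj_eq (addrI lambda)).
  by rewrite addr0 addrA -muE -lE.
move/root_sum_eq0 => /(congr1 size)/eqP; rewrite size_cat addn_eq0 !size_eq0.
by move=> /andP[/eqP sn _]; rewrite muE sn /root_sum big_nil subr0.
Qed.

Section Lift.
Variables (lambda : weight r) (V : lieModule (bkm r)) (x : V).
Hypotheses (sx : singular lambda x) (x0 : x <> 0).

(** Nonvanishing is read off from the map to [V] sending the generator to [x], in place of a PBW
    basis. *)
Lemma verma_gen_neq0 : verma_gen lambda <> 0.
Proof.
have [f mf fE] := verma_universal sx.
by move=> g0; apply: x0; rewrite -fE g0 (morph0 mf).
Qed.

Lemma simple_gen_neq0 : simple_gen lambda <> 0.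
Proof.
move/quot_class_eq0; apply/negP.
exact: gen_notin_rad (verma_generated _) (verma_singular _) verma_gen_neq0.
Qed.

(* The kernel of the map from the Verma module onto [U(g) x] is proper. *)
Lemma fword_lift s : fword s (simple_gen lambda) <> 0 -> fword s x <> 0.
Proof.
have [f mf fE] := verma_universal sx.
move=> sL sx0; apply: sL.
rewrite -(morph_fword (quot_class_morph _)); apply/quot_class_eq0.
have [N NP] := stable_submodule (stable_preim mf (stable_eq0 V)).
apply: (@proper_sub_rad _ N).
  by exists (verma_gen lambda); apply/negP => /NP; rewrite fE.
by apply/NP; rewrite (morph_fword mf) fE.
Qed.

(** [L(lambda)] is a quotient of [U(g) x]; this yields the inclusion of the union in the weights of
    [V]. *)
Lemma wt_simple_lift mu : wt (simple_hw lambda) mu ->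
  exists2 s, fword s x <> 0 & mu = lambda - root_sum s.
Proof.
have [gL sL _] := simple_irreducible lambda.
case=> v [vm v0]; have [s Ls ->] := fspan_weight (proj1 sL) vm (generated_fspan v gL sL) v0.
by exists s => //; apply: fword_lift.
Qed.

End Lift.

End HighestWeight.

(** * Matrices with nonpositive off-diagonal entries *)

Lemma row_sum_eq0 (R : realFieldType) (n : nat) (A : 'M[R]_n) (i : 'I_n) (u : 'I_n -> R) :
  (forall j, i != j -> A i j <= 0) -> (forall j, 0 <= u j) ->
  \sum_(j | j != i) A i j * u j = 0 -> forall j, j != i -> A i j <> 0 -> u j = 0.
Proof.
move=> A0 u0 /eqP; rewrite -oppr_eq0 -sumrN psumr_eq0 => [/allP su j ji Aij|j ji].
  have := su j; rewrite mem_index_enum ji oppr_eq0 mulf_eq0 => /(_ isT).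
  by case/orP=> /eqP.
by rewrite oppr_ge0 mulr_le0_ge0 // A0 // eq_sym.
Qed.

(* Minimise [gam i / (c i - gam i)] over the [i] with [gam i < c i]: along the
   set of minimisers all neighbours of positive content are minimisers again. *)
Lemma min_ratio (R : realFieldType) (n : nat) (A : 'M[R]_n) (gam c : 'I_n -> nat) :
  (forall i j, i != j -> A i j <= 0) ->
  (forall i, (gam i <= c i)%N) -> (exists i, (gam i < c i)%N) ->
  (forall i, (gam i < c i)%N -> A i i <> 2 -> \sum_(j | j != i) A i j * (gam j)%:R = 0) ->
  (forall i, (gam i < c i)%N -> A i i = 2 ->
     0 <= \sum_j A i j * (gam j)%:R /\ \sum_j A i j * (c j - gam j)%:R <= 0) ->
  exists (t : R) (T : {set 'I_n}),
    [/\ 0 <= t, exists i, i \in T,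
        forall i, i \in T -> (gam i < c i)%N /\ (gam i)%:R = t * (c i - gam i)%:R,
        forall i, i \in T -> A i i = 2 -> \sum_j A i j * (gam j)%:R = 0
      & forall i j, i \in T -> A i j <> 0 -> (0 < c j)%N -> j \in T].
Proof.
move=> A0 gc [k gk] im re.
pose ratio i : R := (gam i)%:R / (c i - gam i)%:R.
case: (arg_minP ratio (P := fun i => (gam i < c i)%N) gk) => i0 gi0 min0.
pose t := ratio i0; exists t, [set i | (gam i < c i)%N && (ratio i == t)]%SET.
(* Minimality of [t] gives [u >= 0]; where [c j > 0], the zeros of [u] are exactly the
   minimisers. *)
pose u j : R := (gam j)%:R - t * (c j - gam j)%:R.
have b_gt0 i : (gam i < c i)%N -> 0 < (c i - gam i)%:R :> R.
  by rewrite ltr0n subn_gt0.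
have t_ge0 : 0 <= t by rewrite divr_ge0.
have u_ge0 j : 0 <= u j.
  rewrite /u; have [gj|cj] := ltnP (gam j) (c j).
    by rewrite subr_ge0 -ler_pdivlMr ?b_gt0 //; apply: min0.
  by rewrite (eqP (_ : c j - gam j == 0)%N) ?subn_eq0 // mulr0 subr0.
have uP j : (0 < c j)%N -> u j = 0 -> (gam j < c j)%N && (ratio j == t).
  move=> cj uj; have gj : (gam j < c j)%N.
    rewrite ltn_neqAle gc andbT; apply/eqP => gcj.
    move: uj cj; rewrite /u -gcj subnn mulr0 subr0 => /eqP.
    by rewrite pnatr_eq0 => /eqP ->.
  rewrite gj /= /ratio; apply/eqP; move/subr0_eq: uj => ->.
  by rewrite mulfK // gt_eqF ?b_gt0.
have TP i : (gam i < c i)%N && (ratio i == t) -> u i = 0.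
  case/andP=> gi /eqP ti; rewrite /u -ti /ratio divfK ?subrr //.
  by rewrite gt_eqF ?b_gt0.
have Au i j : j != i -> A i j * u j <= 0.
  by move=> ij; rewrite mulr_le0_ge0 // A0 // eq_sym.
(* At a minimiser [i] the vector [u >= 0] vanishes and [(A u)_i >= 0], so that
   [u] vanishes at the neighbours of [i] as well. *)
have reP i : (gam i < c i)%N && (ratio i == t) -> A i i = 2 ->
    \sum_j A i j * (gam j)%:R = 0 /\ forall j, A i j <> 0 -> u j = 0.
  move=> iT Ai; have [/re/(_ Ai)[Ag Ab] _] := andP iT.
  have uE : \sum_j A i j * u j =
      \sum_j A i j * (gam j)%:R - t * \sum_j A i j * (c j - gam j)%:R.
    rewrite mulr_sumr -sumrB; apply: eq_bigr => j _; rewrite /u; ring.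
  have tAb : t * \sum_j A i j * (c j - gam j)%:R <= 0 by rewrite mulr_ge0_le0.
  have uE' : \sum_(j | j != i) A i j * u j = \sum_j A i j * u j.
    by rewrite [RHS](bigD1 i) //= TP // mulr0 add0r.
  have u_le0 : \sum_(j | j != i) A i j * u j <= 0 by apply: sumr_le0 => j; apply: Au.
  split; first by apply/eqP; rewrite eq_le Ag andbT; lra.
  move=> j Aij; have [->|ji] := eqVneq j i; first exact: TP.
  by apply: (row_sum_eq0 (A0 i) u_ge0) ji Aij; lra.
have imP i : (gam i < c i)%N -> A i i <> 2 -> forall j, j != i -> A i j <> 0 -> gam j = 0%N.
  move=> gi Ai j ji Aij; apply/eqP; rewrite -(eqr_nat R); apply/eqP.
  exact: row_sum_eq0 (A0 i) _ (im i gi Ai) j ji Aij.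
split=> //.
- by exists i0; rewrite inE gi0 eqxx.
- move=> i; rewrite inE => /andP[gi /eqP ri]; split=> //.
  by rewrite -ri /ratio divfK // gt_eqF ?b_gt0.
- by move=> i; rewrite inE => iT Ai; have [] := reP i iT Ai.
- move=> i j; rewrite !inE => iT Aij cj; apply: uP => //.
  have [Ai|/eqP Ai] := eqVneq (A i i) 2; first by have [_] := reP i iT Ai; apply.
  have [->|ji] := eqVneq j i; first exact: TP.
  (* Next to an imaginary minimiser [gam j = 0], so that [u j = - t * c j] is both nonpositive and
     nonnegative. *)
  have gj : gam j = 0%N by apply: imP Aij => //; case/andP: iT.
  apply/eqP; rewrite eq_le u_ge0 andbT /u gj sub0r oppr_le0.
  by rewrite mulr_ge0.
Qed.

(** * Weights of simple modules *)

Section SimpleWeights.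
Variables (R : realType) (n : nat) (A : 'M[R]_n) (r : realization A).
Hypothesis hA : BKM_Cartan A.
Notation K := R[i].
Notation E := (bkm_e r).
Notation F := (bkm_f r).
Notation alpha := (simple_root r).
Notation coroot := (simple_coroot r).
Implicit Types (lambda mu nu eta : weight r) (V : lieModule (bkm r)) (s : seq 'I_n).
Implicit Types (c d : 'I_n -> nat).

Definition content c : weight r := \sum_i alpha i *+ c i.

Lemma content_incr c i k :
  content (fun j => (c j + k * (j == i))%N) = content c + alpha i *+ k.
Proof.
rewrite /content.
under eq_bigr do rewrite mulrnDr.
rewrite big_split /= [X in _ + X](bigD1 i) //= eqxx muln1 [X in _ + (_ + X)]big1 ?addr0 //.
by move=> j /negPf ->; rewrite muln0 mulr0n.
Qed.

Lemma content_coroot c i : content c (coroot i) = (\sum_j A i j * (c j)%:R)%:C%C :> K.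
Proof.
rewrite sum_lfunE rmorph_sum; apply: eq_bigr => j _.
rewrite rmorphM rmorph_nat mulr_natr /= -(simple_root_coroot r i j).
by elim: (c j) => [|k IHk]; rewrite ?mulr0n ?zero_lfunE // !mulrS add_lfunE IHk.
Qed.

Lemma sub_content_coroot lambda c i :
  (lambda - content c) (coroot i) =
    lambda (coroot i) - (\sum_j A i j * (c j)%:R)%:C%C :> K.
Proof. by rewrite add_lfunE opp_lfunE content_coroot. Qed.

Lemma half_real (z : K) (x : R) : z *+ 2 = x%:C%C -> z = (x / 2)%:C%C.
Proof.
move=> zx; apply: (mulIf (_ : 2 != 0 :> K)); first by rewrite pnatr_eq0.
have x2 : x = x / 2 * 2 by rewrite divfK // pnatr_eq0.
by rewrite mulr_natr zx [in LHS]x2 rmorphM rmorph_nat.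
Qed.

Lemma iter_e_fword i k s V (x : V) : i \notin s ->
  iter k (act (E i)) (fword s x) = fword s (iter k (act (E i)) x).
Proof.
elim: k => //= k IHk is_; rewrite IHk //; move: (iter k _ x) => {IHk} y.
elim: s is_ => //= j s IHs; rewrite inE negb_or => /andP[ij /IHs <-].
by apply: act_commute; apply: bracket_EF.
Qed.

Definition power_word d (l : seq 'I_n) := flatten [seq nseq (d i) i | i <- l].

Lemma root_sum_power_word d l : root_sum (power_word d l) = \sum_(i <- l) alpha i *+ d i.
Proof.
elim: l => [|i l IHl]; first by rewrite /root_sum !big_nil.
by rewrite big_cons [power_word _ _]/= root_sum_cat IHl root_sum_nseq.
Qed.

Lemma mem_power_word d l i : i \in power_word d l -> i \in l.
Proof. by case/flatten_mapP => j jl; rewrite mem_nseq => /andP[_ /eqP ->]. Qed.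

(* Raising by the [e_i] in the order opposite to that of [f_i] gives back a
   multiple of [v], since [e_i] commutes with the other [f_j]. *)
Lemma power_word_neq0 V lambda (v : V) d l : singular lambda v -> v <> 0 -> uniq l ->
  (forall i j, (j < d i)%N -> lambda (coroot i) *+ 2 != (A i i)%:C%C *+ j) ->
  fword (power_word d l) v <> 0.
Proof.
move=> [vl ve] v0 + dP; elim/last_ind: l => [//|l i IHl].
rewrite rcons_uniq => /andP[il ul].
rewrite /power_word map_rcons flatten_rcons fword_cat fword_nseq => fw0.
apply: (IHl ul); have il' : i \notin power_word d l by apply: contra il => /mem_power_word.
have := iter_e_fword (d i) (iter (d i) (act (F i)) v) il'.
rewrite fw0 iter_act0.
have [b b0 ->] := iter_e_iter_f (bkm_rank_one r i) (vl (coroot i)) (ve i) (dP i).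
by rewrite fwordZ => /esym/eqP; rewrite scaler_eq0 (negPf b0) => /eqP.
Qed.

Section Simple.
Variables (lambda : weight r) (L : lieModule (bkm r)) (v : L).
Hypotheses (gv : generated v) (sv : singular lambda v).

(** All weights lie below [lambda], so at most [c i] copies of [alpha_i] can be added back. *)
Lemma iter_e_bound c i p (w : L) : weight_space L (lambda - content c) w ->
  iter p (act (E i)) w <> 0 -> (p <= c i)%N.
Proof.
move=> wc ew0; have [s _ sE] := fspan_weight (proj1 sv)
  (weight_space_iter_e i p wc) (generated_fspan _ gv sv) ew0.
have /simple_root_inj/(_ i) -> : content c =
    content (fun j => (count_mem j s + p * (j == i))%N).
  rewrite content_incr /content -root_sum_count.
  apply/eqP; rewrite -subr_eq; apply/eqP/oppr_inj/(addrI lambda).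
  by rewrite -sE opprB addrA addrAC.
by rewrite eqxx muln1 leq_addl.
Qed.

(** This is [f_kernel_weight], with [e_i] nilpotent on [w] by [iter_e_bound], solved for the value
    of [lambda]. *)
Lemma f_kernel_real c i (w : L) : weight_space L (lambda - content c) w -> w <> 0 ->
  act (F i) w = 0 -> exists2 p, (p <= c i)%N &
    lambda (coroot i) = (\sum_j A i j * (c j)%:R - A i i * p%:R / 2)%:C%C.
Proof.
move=> wc w0 fw; have ew : iter (c i).+1 (act (E i)) w = 0.
  by apply: contrapT => /(iter_e_bound wc); rewrite ltnn.
have [p [pc _ _ pE]] := f_kernel_weight (bkm_rank_one r i) (wc (coroot i)) w0 fw ew.
exists p => //.
have /half_real/eqP : (lambda (coroot i) - (\sum_j A i j * (c j)%:R)%:C%C) *+ 2 =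
    (- (A i i *+ p))%:C%C by rewrite -sub_content_coroot pE rmorphN rmorphMn.
rewrite subr_eq -rmorphD => /eqP ->; congr (_%:C%C).
by rewrite -mulr_natr; ring.
Qed.

Hypothesis v0 : v <> 0.

Lemma maximal_weight c d : (forall i, (d i <= c i)%N) -> wt L (lambda - content d) ->
  exists2 d', forall i, (d i <= d' i <= c i)%N & wt L (lambda - content d') /\
    forall i, (d' i < c i)%N -> ~ wt L (lambda - content d' - alpha i).
Proof.
have [m] := ubnP (\sum_i (c i - d i)); elim: m d => // m IHm d lem dc wd.
have [[i [di wi]]|nex] :=
  EM (exists i, (d i < c i)%N /\ wt L (lambda - content d - alpha i)); last first.
  exists d => [i|]; first by rewrite leqnn dc.
  by split=> // i di wi; apply: nex; exists i.
have [|j||d' d'P d'W] := IHm (fun j => (d j + 1 * (j == i))%N).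
- rewrite -ltnS; apply: leq_trans lem.
  rewrite ltnS [in X in (_ < X)%N](bigD1 i) //= (bigD1 i) //= eqxx.
  rewrite -addSn; apply: leq_add; first by rewrite muln1 addn1 subnSK.
  by apply: leq_sum => j /negPf ->; rewrite muln0 addn0.
- by rewrite mul1n; case: eqP => [->|_]; rewrite ?addn1 // addn0.
- by rewrite content_incr mulr1n opprD addrA.
exists d' => // j; have /andP[+ ->] := d'P j; rewrite andbT.
exact/leq_trans/leq_addr.
Qed.

(** The last two alternatives are the exceptions (a) and (b) of the overview, the exponent in (b)
    being [k + 1]. *)
Lemma simple_weights c :
  (forall i, A i i = 2 -> 0 <= lambda (coroot i)) ->
  (forall i, A i i = 2 -> 0 <= (lambda - content c) (coroot i)) ->
  [\/ wt L (lambda - content c),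
      exists2 T : {set 'I_n}, exists i, i \in T &
        forall i, i \in T -> [/\ (0 < c i)%N, lambda (coroot i) = 0 &
          forall j, A i j <> 0 -> (0 < c j)%N -> j \in T]
    | exists i k, [/\ A i i <> 2, A i i <> 0, lambda (coroot i) *+ 2 = (A i i)%:C%C *+ k,
         (k < c i)%N & forall j, j != i -> A i j <> 0 -> c j = 0%N]].
Proof.
move=> l_ge0 c_ge0; have [A_diag _ A_off _] := hA.
(* The first [j < c i] at which the rank one coefficient of [f_i^(j+1) v] vanishes; [find] returns
   [c i] if there is none. *)
pose a i := find (fun j => lambda (coroot i) *+ 2 == (A i i)%:C%C *+ j) (iota 0 (c i)).
have a_le i : (a i <= c i)%N by rewrite -[X in (_ <= X)%N](size_iota 0) find_size.
have a_min i j : (j < a i)%N -> lambda (coroot i) *+ 2 != (A i i)%:C%C *+ j.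
  move=> ja; have /= := before_find 0%N ja; rewrite nth_iota ?add0n => [->//|].
  exact: leq_trans ja (a_le i).
have aE i : (a i < c i)%N -> lambda (coroot i) *+ 2 = (A i i)%:C%C *+ a i.
  rewrite -{1}[c i](size_iota 0) -has_find => ha.
  have := nth_find 0%N ha; rewrite nth_iota ?add0n => [/eqP //|].
  by rewrite -[X in (_ < X)%N](size_iota 0) -has_find.
have aR i : (a i < c i)%N -> lambda (coroot i) = (A i i * (a i)%:R / 2)%:C%C.
  by move/aE => aiE; apply: half_real; rewrite aiE mulr_natr rmorphMn.
have wa : wt L (lambda - content a).
  exists (fword (power_word a (enum 'I_n)) v); split.
    rewrite (_ : content a = root_sum (power_word a (enum 'I_n))).
      by apply: weight_space_fword; case: sv.
    by rewrite root_sum_power_word big_enum.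
  exact: (power_word_neq0 sv v0 (enum_uniq _) a_min).
have [d dP [[w [wd w0]] dmax]] := maximal_weight a_le wa.
have ad i : (a i <= d i)%N by case/andP: (dP i).
have dc i : (d i <= c i)%N by case/andP: (dP i).
have acP i : (d i < c i)%N -> (a i < c i)%N by apply: leq_ltn_trans.
have [cd|/existsNP[k /eqP kd]] := EM (forall i, d i = c i).
  constructor 1; rewrite (_ : content c = content d); first by exists w.
  by apply: eq_bigr => i _; rewrite cd.
have stuck i : (d i < c i)%N -> exists2 p, (p <= d i)%N &
    lambda (coroot i) = (\sum_j A i j * (d j)%:R - A i i * p%:R / 2)%:C%C.
  move=> di; apply: (f_kernel_real wd w0); apply: contrapT => fw.
  by apply: (dmax i di); exists (act (F i) w); split=> //; apply: weight_space_f.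
(* Comparing [stuck] with [aR] gives the sum the value [A i i * (a i + p - 2 d i) / 2], which is
   nonnegative since [a i] and [p] are at most [d i]; its terms are nonpositive. *)
have im_sum i : (d i < c i)%N -> A i i <> 2 ->
    \sum_(j | j != i) A i j * (d j)%:R = 0.
  move=> di Ai; have [p pd pE] := stuck i di.
  have A0 : A i i <= 0 by case: (A_diag i).
  have := aR i (acP i di); rewrite pE => /complexI; rewrite (bigD1 i) //= => sE.
  have ai : (a i)%:R <= (d i)%:R :> R by rewrite ler_nat.
  have pi : p%:R <= (d i)%:R :> R by rewrite ler_nat.
  apply/eqP; rewrite eq_le sumr_le0 /= => [|j ji]; last first.
    by rewrite mulr_le0_ge0 ?A_off // eq_sym.
  have -> : \sum_(j | j != i) A i j * (d j)%:R =
    A i i * (((a i)%:R - (d i)%:R) + (p%:R - (d i)%:R)) / 2 by lra.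
  by rewrite divr_ge0 // mulr_le0 // -oppr_ge0; lra.
have [|i di Ai|t [T [t0 [i0 i0T] TP Tre Tnb]]] := min_ratio A_off dc _ im_sum.
- by exists k; rewrite ltn_neqAle kd dc.
(* For real [i] the value of [lambda] is [(A d)_i - p]. Its nonnegativity bounds [(A d)_i] below,
   and that of [lambda - content c] gives [(A (c - d))_i <= -p]. *)
- have [p pd pE] := stuck i di.
  have := l_ge0 i Ai; have := c_ge0 i Ai.
  rewrite sub_content_coroot pE -rmorphB !ler0c Ai.
  have -> : \sum_j A i j * (c j - d j)%:R = \sum_j A i j * (c j)%:R - \sum_j A i j * (d j)%:R.
    by rewrite -sumrB; apply: eq_bigr => j _; rewrite natrB // mulrBr.
  have : 0 <= p%:R :> R by [].
  by split; lra.
(* On [T] the sum [(A d)_i] vanishes for real [i], so the value is [-p <= 0]. *)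
have Tl i : i \in T -> A i i = 2 -> lambda (coroot i) = 0.
  move=> iT Ai; have [di _] := TP i iT; have [p pd pE] := stuck i di.
  apply/eqP; rewrite eq_le l_ge0 // andbT pE Tre // Ai sub0r.
  by rewrite -[0](rmorph0 (real_complex R)) lecR oppr_le0 divr_ge0 // mulr_ge0.
have [lT|/existsNP[i /not_implyP[iT li]]] := EM (forall i, i \in T -> lambda (coroot i) = 0).
  constructor 2; exists T; first by exists i0.
  move=> i iT; split=> [||j Aij cj]; [|exact: lT|exact: Tnb Aij cj].
  by have [di _] := TP i iT; apply: leq_ltn_trans di.
have [di dE] := TP i iT; have aiE := aE i (acP i di).
have Ai : A i i <> 2 by move=> /(Tl i iT).
constructor 3; exists i, (a i); split=> //.
- move=> Aii; apply: li; apply/eqP; move/eqP: aiE.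
  by rewrite Aii rmorph0 mul0rn mulrn_eq0.
- exact: acP.
(* A neighbour [j] in the support would lie in [T] with [d j = 0]. Then [t = 0], hence
   [d i = a i = 0] and [lambda] vanishes at the coroot of [i]. *)
move=> j ji Aij; apply/eqP/negPn; rewrite -lt0n; apply/negP => cj.
have [dj] := TP j (Tnb i j iT Aij cj).
rewrite (row_sum_eq0 (A_off i) (fun j => ler0n _ (d j)) (im_sum i di Ai)) // => /esym/eqP.
rewrite mulf_eq0 pnatr_eq0 subn_eq0 leqNgt dj orbF => /eqP tz.
move: dE; rewrite tz mul0r => /eqP; rewrite pnatr_eq0 => /eqP dz.
apply: li; apply/eqP; move: (ad i) aiE; rewrite dz leqn0 => /eqP -> /eqP.
by rewrite mulr0n mulrn_eq0.
Qed.
End Simple.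
End SimpleWeights.

(** * Integrable modules *)

Section IntegrableModules.
Variables (R : realType) (n : nat) (A : 'M[R]_n) (r : realization A).
Hypothesis hA : BKM_Cartan A.
Notation K := R[i].
Notation E := (bkm_e r).
Notation F := (bkm_f r).
Notation alpha := (simple_root r).
Notation coroot := (simple_coroot r).
Implicit Types (lambda mu nu eta : weight r) (V : lieModule (bkm r)) (s : seq 'I_n).
Implicit Types (c d : 'I_n -> nat).

Definition real_nilpotent V : Prop :=
  forall i, A i i = 2 -> forall w : V, exists N, iter N (act (F i)) w = 0.

(** By [nilpotent_act] it suffices that [ad f_i] is nilpotent on the Chevalley generators; for [f_j]
    with [j != i] this is the Serre relation. *)
Lemma nilpotent_stable V i : A i i = 2 ->
  stable (fun w : V => exists N, iter N (act (F i)) w = 0).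
Proof.
move=> Ai; have adn z k (w : V) : iter k (bracket (F i)) z = 0 ->
    (exists N, iter N (act (F i)) w = 0) -> exists N, iter N (act (F i)) (act z w) = 0.
  by move=> zk [N wN]; exists (N + k)%N; apply: nilpotent_act.
have FH h : bracket (F i) (bkm_h h) = alpha i h *: F i.
  by rewrite bracketC bracket_HF scaleNr opprK.
split.
- by exists 0%N.
- move=> c u w [N uN] [M wM]; exists (maxn N M).
  rewrite iter_actD iter_actZ (iter_act_ge (leq_maxl N M) uN).
  by rewrite (iter_act_ge (leq_maxr N M) wM) scaler0 addr0.
- move=> h w; apply: (adn _ 2).
  by rewrite [LHS]iterS [iter 1 _ _]iterS FH bracketZr bracketxx scaler0.
- move=> j w; apply: (adn _ 3); rewrite !iterS [bracket (F i) (E j)]bracketC.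
  have [->|/bracket_EF ->] := eqVneq j i; last by rewrite oppr0 !bracket0r.
  rewrite (bracket_ef (bkm_rank_one r i)) bracketNr FH bracketNr bracketZr.
  by rewrite bracketxx scaler0 oppr0.
- move=> j w; have [->|ji] := eqVneq j i.
    by apply: (adn _ 1); apply: bracketxx.
  have [_ _ _ /(_ i j Ai ji) [k Aij]] := hA.
  by apply: (adn _ k.+1); apply: serre_F.
Qed.

Lemma integrable_real_nilpotent lambda V (x : V) :
  generated x -> weight_space V lambda x -> integrable lambda V -> real_nilpotent V.
Proof.
move=> gx xl iV i Ai; apply: gx; first exact: nilpotent_stable.
by have [k [_ kx]] := iV i Ai; exists k.+1; apply: kx.
Qed.

(** [f_kernel_weight] with [e_i] and [f_i] exchanged: integrality passes from the highest weight to
    every nonzero singular vector. *)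
Lemma singular_real_weight lambda V (x : V) i : real_nilpotent V -> A i i = 2 ->
  singular lambda x -> x <> 0 ->
  exists2 k, lambda (coroot i) = k%:R & iter k.+1 (act (F i)) x = 0.
Proof.
move=> nV Ai [xl xe] x0; have [N fN] := nV i Ai x.
have [|p [_ _ fp pE]] := f_kernel_weight (rank_one_sym (bkm_rank_one r i))
  (t := - lambda (coroot i)) _ x0 (xe i) fN.
  by rewrite actNl xl scaleNr.
exists p => //; move/eqP: pE; rewrite mulNrn eqr_opp Ai => /eqP pE.
by apply: (mulIf (_ : 2 != 0 :> K)); rewrite ?pnatr_eq0 // mulr_natr pE rmorph_nat mulr_natl.
Qed.

Lemma act_f_fword h s V (x : V) :
  (forall j, j \in s -> j != h -> A h j = 0) ->
  act (F h) (fword s x) = fword s (act (F h) x).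
Proof.
elim: s => //= j s IHs hs; rewrite -IHs; last first.
  by move=> l ls; apply: hs; rewrite inE ls orbT.
apply: act_commute; have [->|jh] := eqVneq j h; first exact: bracketxx.
by apply/bracket_FF/hs => //; rewrite inE eqxx.
Qed.

Lemma fword_perm s s' V (x : V) :
  (forall i j, i \in s -> j \in s -> i != j -> A i j = 0) -> perm_eq s s' ->
  fword s x = fword s' x.
Proof.
elim: s s' => [|i s IHs] s' As ss'.
  by move: ss'; rewrite perm_sym => /perm_nilP ->.
have : i \in s' by rewrite -(perm_mem ss') inE eqxx.
move=> /path.splitPr is'; case: is' ss' => p q; rewrite perm_sym perm_catC /= perm_cons => ss'.
rewrite fword_cat /= -act_f_fword.
  rewrite -fword_cat -(IHs (p ++ q)) //.
    by move=> a b as_ bs; apply: As; rewrite inE ?as_ ?bs orbT.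
  by rewrite perm_sym perm_catC.
move=> j jp ji; apply: As; rewrite ?inE ?eqxx // 1?eq_sym //.
by rewrite -(perm_mem ss') mem_cat jp !orbT.
Qed.

Lemma fword_extract h s V (x : V) :
  (forall j, j \in s -> j != h -> A h j = 0) ->
  fword s x = fword [seq j <- s | j != h] (iter (count_mem h s) (act (F h)) x).
Proof.
elim: s => //= j s IHs hs; rewrite IHs; last first.
  by move=> l ls; apply: hs; rewrite inE ls orbT.
have [->|//] := eqVneq j h; rewrite -act_f_fword // => l.
by rewrite mem_filter => /andP[_ ls] lh; apply: hs; rewrite ?inE ?ls ?orbT.
Qed.

End IntegrableModules.

Lemma has_split_last (T : Type) (a : pred T) (l : seq T) : has a l ->
  exists l1 h l2, [/\ l = l1 ++ h :: l2, a h & ~~ has a l2].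
Proof.
elim: l => //= x l IHl; have [al _|al] := boolP (has a l).
  by have [l1 [h [l2 [-> ah al2]]]] := IHl al; exists (x :: l1), h, l2.
by rewrite orbF => ax; exists [::], x, l.
Qed.

(** * Weights that are nonnegative at the real coroots *)

Section Dominant.
Variables (R : realType) (n : nat) (A : 'M[R]_n) (r : realization A).
Hypothesis hA : BKM_Cartan A.
Notation K := R[i].
Notation E := (bkm_e r).
Notation F := (bkm_f r).
Notation alpha := (simple_root r).
Notation coroot := (simple_coroot r).
Implicit Types (lambda mu nu eta : weight r) (V : lieModule (bkm r)) (s : seq 'I_n).
Implicit Types (c d : 'I_n -> nat) (p : ipair n).

Definition ipair_word p : seq 'I_n := 
  power_word p.2 [seq i <- index_enum 'I_n | i \in p.1].

Lemma prod_fE p V (x : V) : prod_f p x = fword (ipair_word p) x.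
Proof.
rewrite /prod_f /ipair_word -big_filter.
elim: (filter _ _) => [|i l IHl]; first by rewrite big_nil.
by rewrite big_cons /= IHl fword_cat fword_nseq.
Qed.

Lemma shiftedE lambda p : shifted lambda p = lambda - root_sum (ipair_word p).
Proof. by rewrite root_sum_power_word big_filter. Qed.

Lemma singular_iter_f lambda V (x : V) h m : singular lambda x ->
  lambda (coroot h) *+ 2 = (A h h)%:C%C *+ m ->
  singular (lambda - alpha h *+ m.+1) (iter m.+1 (act (F h)) x).
Proof.
move=> [xl xe] lh; split; first exact: weight_space_iter_f.
move=> i; have [->|ih] := eqVneq i h.
  exact: (act_e_iter_f0 (bkm_rank_one r h) (xl (coroot h)) (xe h) lh).
by rewrite act_iter_commute ?xe ?iter_act0 // bracket_EF.
Qed.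

(** In the exceptional cases of [simple_weights] the word is rearranged so that a singular power
    [f_h^(m+1)] acts first. The last clause serves to keep the nodes chosen later nonadjacent to
    [h]. *)
Lemma reduction_step lambda V (x : V) s :
  real_nilpotent V -> singular lambda x -> fword s x <> 0 ->
  (forall i, A i i = 2 -> 0 <= (lambda - root_sum s) (coroot i)) ->
  wt (simple_hw lambda) (lambda - root_sum s) \/
  exists h m s', [/\ A h h <> 2, perm_eq s (nseq m.+1 h ++ s'),
    fword s x = fword s' (iter m.+1 (act (F h)) x),
    lambda (coroot h) *+ 2 = (A h h)%:C%C *+ m &
    forall i, i \in s -> i != h -> A h i <> 0 -> lambda (coroot i) = 0].
Proof.
move=> nV sx sx0 dom.
have x0 : x <> 0 by move=> x0; apply: sx0; rewrite x0 fword0.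
have [gL sL _] := simple_irreducible lambda.
pose c i := count_mem i s.
have cs : content r c = root_sum s by rewrite root_sum_count.
have cP i : (0 < c i)%N = (i \in s) by rewrite -has_count has_pred1.
have [i Ai|i Ai||[T [i0 i0T] TP]|[h [m [Ah _ lh mh hP]]]] :=
  simple_weights hA gL sL (simple_gen_neq0 sx x0) (c := c).
- by have [k -> _] := singular_real_weight nV Ai sx x0.
- by rewrite cs; apply: dom.
- by rewrite cs; left.
(* Take for [h] the letter in [T] that acts first: those acting before it are outside [T], hence not
   adjacent to [h], and commute with [f_h]. *)
- right; have [|s1 [h [s2 [sE hT s2T]]]] := has_split_last (a := mem T) (l := s).
    by apply/hasP; exists i0 => //; rewrite -cP; have [] := TP i0 i0T.
  have [_ lh Th] := TP h hT.
  have s2h j : j \in s2 -> j != h -> A h j = 0.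
    move=> js2 jh; apply: contrapT => Ahj; case/hasP: s2T; exists j => //.
    by apply: Th => //; rewrite cP sE mem_cat inE js2 !orbT.
  have fE : fword s x = fword (s1 ++ s2) (act (F h) x).
    by rewrite sE !fword_cat /= (act_f_fword _ s2h).
  exists h, 0%N, (s1 ++ s2); split=> //.
  (* A real [h] with value 0 would give [f_h x = 0]. *)
  + move=> Ah; have [k kE kx] := singular_real_weight nV Ah sx x0.
    move: kx; have -> : k = 0%N by apply/eqP; rewrite -(eqr_nat K) -kE lh.
    by move=> /= kx; apply: sx0; rewrite fE kx fword0.
  + by rewrite sE perm_catC /= perm_cons perm_catC.
  + by rewrite lh mul0rn mulr0n.
  + by move=> i is_ ih Ahi; have [] := TP i (Th i Ahi _); rewrite ?cP.
right; have sh j : j \in s -> j != h -> A h j = 0.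
  move=> js jh; apply: contrapT => Ahj.
  by move: js; rewrite -cP (hP j).
have cE : count_mem h s = ((count_mem h s - m.+1) + m.+1)%N by rewrite subnK.
(* All letters [h] commute past the others; [m+1] of them are applied to [x], the surplus ends the
   new word. *)
exists h, m, ([seq j <- s | j != h] ++ nseq (count_mem h s - m.+1) h); split=> //.
- apply/allP => j _; apply/eqP; rewrite /= !count_cat !count_nseq count_filter /=.
  have [->|jh] := eqVneq j h.
    have -> : count (predI (pred1 h) (fun l => l != h)) s = 0%N.
      by apply/eqP; rewrite -leqn0 leqNgt -has_count; apply/hasPn => l _ /=; case: eqP.
    by rewrite !mul1n add0n addnA add1n addnC.
  rewrite ?[h == j]eq_sym ?(negPf jh) !mul0n addn0 add0n; apply: eq_count => l /=.
  by case: eqP => // ->.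
- by rewrite fword_cat fword_nseq -iterD -cE; apply: fword_extract.
- by move=> i is_ ih Ahi; case: Ahi; apply: sh.
Qed.

(* At [lambda - m alpha_h] the value at the coroot of an imaginary node [i] is
   a positive real, so [i] leaves [J], if [i = h] with [A h h < 0], or if [i] is
   a neighbour of [h] with [lambda(alpha_i^vee) = 0]. *)
Lemma in_J_positive mu i (x : R) : A i i <> 2 -> mu (coroot i) = x%:C%C ->
  in_J mu i -> x <= 0.
Proof.
have [A_diag _ _ _] := hA.
move=> Ai mx [k]; rewrite mx -(rmorph_nat (real_complex R)) -rmorphM => /complexI ->.
have A0 : A i i <= 0 by case: (A_diag i).
by rewrite mulr_le0_ge0 // ler_pdivrMr ?mul0r.
Qed.

(** Induction on the length of the word, [x] being replaced by the singular vector of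
    [reduction_step]. The last clause is carried along so that [in_J_positive] and the neighbour
    condition apply to the nodes of the smaller pair. *)
Lemma dominant_weights lambda V (x : V) s :
  real_nilpotent V -> singular lambda x -> fword s x <> 0 ->
  (forall i, A i i = 2 -> 0 <= (lambda - root_sum s) (coroot i)) ->
  exists p, [/\ Indep lambda p, prod_f p x <> 0,
    wt (simple_hw (shifted lambda p)) (lambda - root_sum s) &
    forall i, i \in p.1 -> i \in s /\ A i i <> 2].
Proof.
have [A_diag A_sym A_off _] := hA.
move=> nV; have [N] := ubnP (size s); elim: N s lambda x => // N IHN s lambda x.
rewrite ltnS => sN sx sx0 dom.
have [wL|[h [m [s' [Ah ss' fE lh hs]]]]] := reduction_step nV sx sx0 dom.
  pose p0 : ipair n := (finset.set0, [ffun=> 0%N]); exists p0.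
  have w0 : ipair_word p0 = [::].
    by rewrite /ipair_word /= (eq_filter (a2 := pred0)) ?filter_pred0 // => i; rewrite inE.
  split; rewrite ?prod_fE ?shiftedE ?w0 /=.
  - by split=> [i|i j|i|i|i] /=; rewrite ?inE // ffunE.
  - by move=> x0; apply: sx0; rewrite x0 fword0.
  - by rewrite {1}/root_sum big_nil subr0.
  - by move=> i; rewrite inE.
set x' := iter m.+1 (act (F h)) x in fE.
have sx' : singular (lambda - alpha h *+ m.+1) x' by apply: singular_iter_f.
have rsE : root_sum s = alpha h *+ m.+1 + root_sum s' :> weight r.
  by rewrite -root_sum_nseq -root_sum_cat; apply: perm_big.
have s's i : i \in s' -> i \in s by move=> is'; rewrite (perm_mem ss') mem_cat is' orbT.
have hin : h \in s by rewrite (perm_mem ss') mem_cat mem_nseq eqxx.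
have muE : lambda - alpha h *+ m.+1 - root_sum s' = lambda - root_sum s.
  by rewrite rsE opprD addrA.
have [|||[H d] [indp pf wp pS]] := IHN s' (lambda - alpha h *+ m.+1) x' _ sx'.
- by apply: leq_trans sN; rewrite (perm_size ss') size_cat size_nseq addSn ltnS leq_addl.
- by rewrite -fE.
- by move=> i Ai; rewrite muE; apply: dom.
have l'E i : (lambda - alpha h *+ m.+1) (coroot i) =
    lambda (coroot i) - (A i h *+ m.+1)%:C%C :> K.
  rewrite add_lfunE opp_lfunE rmorphMn /= -(simple_root_coroot r i h).
  congr (_ - _); elim: m.+1 => [|k IHk]; first by rewrite !mulr0n zero_lfunE.
  by rewrite !mulrS add_lfunE IHk.
have lhR : lambda (coroot h) = (A h h * m%:R / 2)%:C%C.
  by apply: half_real; rewrite lh mulr_natr rmorphMn.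
have [inJ ind cond0 cond1 out] := indp; rewrite /= in inJ ind cond0 cond1 out pS.
have A_neg i : A i i <> 2 -> A i i <= 0 by case: (A_diag i).
(* A neighbour [i] of [h] would have the value [-(m+1) A i h > 0] at its coroot after the shift. *)
have nadj i : i \in H -> i != h -> A h i = 0.
  move=> iH ih; apply: contrapT => Ahi; have [is' Ai] := pS i iH.
  have Aih : A i h < 0.
    by rewrite lt_neqAle A_off // andbT; apply/eqP => /A_sym.
  have := in_J_positive (x := - (A i h *+ m.+1)) Ai _ (inJ i iH).
  rewrite l'E (hs i (s's i is') ih Ahi) sub0r rmorphN => /(_ erefl).
  by rewrite oppr_le0 leNgt pmulrn_llt0 ?Aih.
(* After the shift the value at the coroot of [h] is [- A h h * (m/2 + 1)], positive if [A h h < 0];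
   only an isotropic [h] can be chosen again. *)
have hH : h \in H -> A h h = 0.
  move=> hH; apply/eqP; rewrite eq_le A_neg //= leNgt; apply/negP => Ah0.
  have := in_J_positive (x := A h h * m%:R / 2 - A h h *+ m.+1) Ah _ (inJ h hH).
  rewrite l'E lhR rmorphB => /(_ erefl).
  have -> : A h h * m%:R / 2 - A h h *+ m.+1 = - A h h * (m%:R / 2 + 1).
    by rewrite -[_ *+ m.+1]mulr_natr -natr1; field.
  by rewrite leNgt mulr_gt0 ?oppr_gt0 // ltr_wpDl // divr_ge0.
have lE i : i \in H -> i != h -> (lambda - alpha h *+ m.+1) (coroot i) = lambda (coroot i) :> K.
  move=> iH ih; rewrite l'E (_ : A i h = 0) ?mul0rn ?subr0 //.
  exact/A_sym/nadj.
(* Exponents at [h] add up; [d h] is zero unless [h] is already in [H]. *)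
pose p : ipair n := (h |: H, [ffun i => (d i + m.+1 * (i == h))%N]).
have p2E i : p.2 i = (d i + m.+1 * (i == h))%N by rewrite ffunE.
have p1E i : (i \in p.1) = (i == h) || (i \in H) by rewrite !inE.
have ind_p : independent A p.1.
  move=> i j; rewrite !p1E => /predU1P[->|iH] /predU1P[->|jH] ij.
  - by rewrite eqxx in ij.
  - by apply: nadj => //; rewrite eq_sym.
  - exact/A_sym/nadj.
  - exact: ind.
have rs_p : root_sum (ipair_word p) = root_sum (nseq m.+1 h ++ ipair_word (H, d)) :> weight r.
  have content_word (q : ipair n) : (forall i, i \notin q.1 -> q.2 i = 0%N) ->
      root_sum (ipair_word q) = content r q.2.
    move=> q0; rewrite root_sum_power_word big_filter big_mkcond /=.
    by apply: eq_bigr => i _; case: ifPn => // /q0 ->; rewrite mulr0n.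
  rewrite root_sum_cat root_sum_nseq !content_word //=.
    by rewrite addrC -content_incr; apply: eq_bigr => i _; rewrite ffunE.
  move=> i; rewrite p1E negb_or p2E => /andP[/negPf -> iH].
  by rewrite out // muln0.
exists p; split.
- split.
  + move=> i; rewrite p1E => /predU1P[->|iH].
      exists m; rewrite lhR -(rmorph_nat (real_complex R)) -rmorphM.
      by congr (_%:C%C); lra.
    have [->|ih] := eqVneq i h.
      exists m; rewrite lhR -(rmorph_nat (real_complex R)) -rmorphM.
      by congr (_%:C%C); lra.
    by have [k kE] := inJ i iH; exists k; rewrite -lE.
  + exact: ind_p.
  + move=> i; rewrite p1E p2E => iP Ai.
    have [ihE|ih] := eqVneq i h.
      have iH : i \notin H by apply/negP; rewrite ihE in Ai * => /hH.
      rewrite ihE in iH Ai *; rewrite out // muln1 add0n lhR.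
      have -> : (2 : K) = (2 : R)%:C%C by rewrite rmorph_nat.
      rewrite -fmorphV -!rmorphM -(rmorph1 (real_complex R)) -rmorphD.
      rewrite -(rmorph_nat (real_complex R)); congr (_%:C%C).
      by rewrite -natr1; field; apply/eqP.
    rewrite muln0 addn0 -lE ?cond0 //; first by case/predU1P: iP => // /eqP; rewrite (negPf ih).
    by case/predU1P: iP => // /eqP; rewrite (negPf ih).
  + move=> i; rewrite p1E p2E => /predU1P[->|iH] Ai; first by rewrite eqxx muln1 addnS.
    by apply: leq_trans (cond1 i iH Ai) _; apply: leq_addr.
  + move=> i; rewrite p1E negb_or p2E => /andP[/negPf -> iH].
    by rewrite muln0 addn0 out.
- move: pf; rewrite !prod_fE.
  have -> : fword (ipair_word p) x = fword (ipair_word (H, d)) x'; last by [].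
  rewrite /x' -fword_nseq -fword_cat; apply: fword_perm.
    move=> i j /mem_power_word + /mem_power_word.
    by rewrite !mem_filter => /andP[+ _] /andP[+ _]; apply: ind_p.
  by apply: (root_sum_inj (r := r)); rewrite rs_p !root_sum_cat addrC.
- rewrite shiftedE rs_p root_sum_cat root_sum_nseq opprD addrA -muE.
  by rewrite -shiftedE.
- move=> i; rewrite p1E => /predU1P[->//|iH].
  by have [is' Ai] := pS i iH; split=> //; apply: s's.
Qed.

End Dominant.

(** * Real reflections, independent sets of nodes and Jordan-Hölder factors *)

Section WeightsOfIntegrable.
Variables (R : realType) (n : nat) (A : 'M[R]_n) (r : realization A).
Hypothesis hA : BKM_Cartan A.
Notation K := R[i].
Notation E := (bkm_e r).
Notation F := (bkm_f r).
Notation alpha := (simple_root r).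
Notation coroot := (simple_coroot r).
Implicit Types (lambda mu nu eta : weight r) (V : lieModule (bkm r)) (s : seq 'I_n).
Implicit Types (c d : 'I_n -> nat) (p : ipair n).

Lemma e_nilpotent lambda mu V (x w : V) i : generated x -> singular lambda x ->
  weight_space V mu w -> exists N, iter N (act (E i)) w = 0.
Proof.
move=> gx sx wm; have [->|w0] := EM (w = 0); first by exists 0%N.
have [s _ muE] := fspan_weight (proj1 sx) wm (generated_fspan _ gx sx) w0.
rewrite muE root_sum_count in wm; exists (count_mem i s).+1.
by apply: contrapT => /(iter_e_bound gx sx (c := fun j => count_mem j s) wm); rewrite ltnn.
Qed.

Lemma root_sum_coroot_int s i : A i i = 2 ->
  exists z : int, root_sum s (coroot i) = z%:~R :> K.
Proof.
have [_ _ _ A_int] := hA; move=> Ai.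
elim: s => [|j s [z zE]]; first by exists 0; rewrite /root_sum big_nil zero_lfunE.
have [y yE] : exists y : int, alpha j (coroot i) = y%:~R :> K.
  rewrite simple_root_coroot; have [->|ji] := eqVneq j i.
    by exists 2; rewrite Ai rmorph_nat.
  by have [k ->] := A_int i j Ai ji; exists (- k%:Z); rewrite rmorphN rmorph_nat rmorphN.
by exists (y + z); rewrite root_sum_cons add_lfunE zE yE rmorphD.
Qed.

(** [iter_f_inj] for the exchanged triple, integrability supplying the nilpotency of [f_i]. *)
Lemma reflect_up V mu (y : V) i q : real_nilpotent V -> A i i = 2 ->
  weight_space V mu y -> mu (coroot i) = - q%:R -> y <> 0 ->
  iter q (act (E i)) y <> 0.
Proof.
move=> nV Ai ym mq y0 ey; apply: y0.
have := rank_one_sym (bkm_rank_one r i); rewrite Ai => R1.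
have [N fN] := nV i Ai y.
apply: (iter_f_inj (N := N) (k := q) (e := F i) (h := - bkm_h (coroot i))) ey => //.
  by rewrite rmorph_nat in R1.
by rewrite actNl ym mq scaleNr opprK.
Qed.

Lemma reflect_down lambda mu V (x w : V) i q : generated x -> singular lambda x ->
  A i i = 2 -> weight_space V mu w -> mu (coroot i) = q%:R -> w <> 0 ->
  iter q (act (F i)) w <> 0.
Proof.
move=> gx sx Ai wm mq w0 fw; apply: w0.
have := bkm_rank_one r i; rewrite Ai rmorph_nat => R1.
have [N eN] := e_nilpotent i gx sx wm.
by apply: (iter_f_inj R1 _ eN fw); rewrite wm mq.
Qed.

(** If [mu] is negative at a real coroot, its reflection is a weight of [V] reached by a shorter
    word. The pair found there also serves [mu], by reflecting back inside the simple module, where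
    [e_i] is nilpotent on weight vectors. *)
Lemma integrable_weights lambda V (x : V) s : real_nilpotent V ->
  generated x -> singular lambda x -> fword s x <> 0 ->
  exists p, [/\ Indep lambda p, prod_f p x <> 0 &
    wt (simple_hw (shifted lambda p)) (lambda - root_sum s)].
Proof.
move=> nV gx sx; have [N] := ubnP (size s); elim: N s => // N IHN s sN sx0.
have x0 : x <> 0 by move=> x0; apply: sx0; rewrite x0 fword0.
set mu := lambda - root_sum s.
have [dom|/existsNP[i /not_implyP[Ai /negP mi]]] :=
  EM (forall i, A i i = 2 -> 0 <= mu (coroot i) :> K).
  by have [p [? ? ? _]] := dominant_weights hA nV sx sx0 dom; exists p.
(* The value is an integer, so failing to be nonnegative means being negative. *)
have [q mq] : exists q : nat, mu (coroot i) = - q.+1%:R.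
  have [k lk _] := singular_real_weight nV Ai sx x0.
  have [z zE] := root_sum_coroot_int s Ai.
  move: mi; rewrite /mu add_lfunE opp_lfunE lk zE -[k%:R]/(k%:Z%:~R) -rmorphB ler0z.
  by case: (k%:Z - z) => // q _; exists q; rewrite NegzE rmorphN.
have ym := weight_space_fword s (proj1 sx).
have e0 := reflect_up nV Ai ym mq sx0.
have em := weight_space_iter_e i q.+1 ym.
have [s' s'x s'E] := fspan_weight (proj1 sx) em (generated_fspan _ gx sx) e0.
have rsE : root_sum s = root_sum (s' ++ nseq q.+1 i) :> weight r.
  rewrite root_sum_cat root_sum_nseq; apply/oppr_inj/(addrI lambda).
  by rewrite opprD addrA -s'E addrK.
have [|p [ip px [w [wm w0]]]] := IHN s' _ s'x.
  rewrite -ltnS; apply: leq_trans sN.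
  by rewrite (perm_size (root_sum_inj rsE)) size_cat size_nseq addnS leq_addr.
exists p; split=> //.
have [gL sL _] := simple_irreducible (shifted lambda p).
exists (iter q.+1 (act (F i)) w); split; last first.
  apply: (reflect_down gL sL Ai wm) w0.
  rewrite -s'E add_lfunE mq (_ : (alpha i *+ q.+1) (coroot i) = (q.+1 * 2)%:R).
    by rewrite mulnC mul2n -addnn natrD addKr.
  elim: q.+1 => [|m IHm]; first by rewrite mulr0n zero_lfunE.
  by rewrite mulrS add_lfunE IHm simple_root_coroot Ai rmorph_nat mulSn natrD.
have := weight_space_iter_f i q.+1 wm.
by rewrite -s'E addrK.
Qed.

(** Translates the exponents of a pair into the rank one condition of [singular_iter_f]; at an
    isotropic node both sides are zero for every exponent. *)
Lemma indep_coroot lambda p i : Indep lambda p -> i \in p.1 ->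
  exists2 m, p.2 i = m.+1 & lambda (coroot i) *+ 2 = (A i i)%:C%C *+ m.
Proof.
case=> inJ _ cond0 cond1 _ ip; have [k kE] := inJ i ip.
have lE : lambda (coroot i) *+ 2 = (A i i)%:C%C *+ k.
  rewrite kE -(rmorph_nat (real_complex R)) -rmorphM -!rmorphMn; congr (_%:C%C).
  by rewrite -mulr_natr; field.
have [Ai|/eqP Ai] := eqVneq (A i i) 0.
  have := cond1 i ip Ai; case: (p.2 i) => // m _; exists m => //.
  by rewrite lE Ai rmorph0 !mul0rn.
exists k => //; apply/eqP; rewrite -(eqr_nat K) cond0 // kE -[k.+1%:R]natr1.
have -> : (2 : K) = (2 : R)%:C%C by rewrite rmorph_nat.
rewrite mulrA -fmorphV -!rmorphM (_ : 2 / A i i * (A i i / 2) = 1) ?rmorph1 ?mul1r //.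
by field; apply/eqP.
Qed.

(** By independence, lowering along the other nodes leaves the value at the coroot of [i] unchanged,
    so the rank one condition persists. *)
Lemma power_word_singular lambda V (x : V) d (l : seq 'I_n) :
  singular lambda x -> uniq l ->
  (forall i j, i \in l -> j \in l -> i != j -> A i j = 0) ->
  (forall i, i \in l -> exists2 m, d i = m.+1 & lambda (coroot i) *+ 2 = (A i i)%:C%C *+ m) ->
  singular (lambda - root_sum (power_word d l)) (fword (power_word d l) x).
Proof.
move=> sx; elim: l => [|i l IHl] /=; first by rewrite /root_sum big_nil subr0.
move=> /andP[il ul] Al dl.
have in_l j : j \in l -> j \in i :: l by move=> jl; rewrite inE jl orbT.
have {IHl} sl := IHl ul (fun a b al bl => Al a b (in_l a al) (in_l b bl))
  (fun a al => dl a (in_l a al)).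
have [|m dm lm] := dl i; first by rewrite inE eqxx.
rewrite [power_word _ _]/= root_sum_cat root_sum_nseq [alpha i *+ _ + _]addrC opprD addrA.
rewrite fword_cat fword_nseq dm; apply: singular_iter_f => //.
rewrite add_lfunE opp_lfunE root_sum_power_word sum_lfunE big1_seq ?subr0 // => j /andP[_ jl].
have ij : i != j by apply: contra il => /eqP ->.
have aij : alpha j (coroot i) = 0 :> K.
  by rewrite simple_root_coroot (Al i j (mem_head _ _) (in_l j jl) ij) rmorph0.
by elim: (d j) => [|k IHk]; rewrite ?mulr0n ?zero_lfunE // mulrS add_lfunE IHk aij addr0.
Qed.

Lemma prod_f_singular lambda V (x : V) p : Indep lambda p -> singular lambda x ->
  singular (shifted lambda p) (prod_f p x).
Proof.
move=> ip sx; rewrite shiftedE prod_fE; apply: power_word_singular => //.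
- by rewrite filter_uniq // index_enum_uniq.
- case: ip => _ ind _ _ _ i j; rewrite !mem_filter => /andP[+ _] /andP[+ _].
  exact: ind.
- by move=> i; rewrite mem_filter => /andP[ip1 _]; apply: indep_coroot.
Qed.

(** [lambda + alpha_i] is not below [lambda]. Needed since holes are defined by all vectors of the
    highest weight space. *)
Lemma highest_weight_space_singular lambda V (x v : V) :
  generated x -> singular lambda x -> weight_space V lambda v -> singular lambda v.
Proof.
move=> gx sx vl; split=> // i; apply: contrapT => ev.
have [s _ /eqP] :=
  fspan_weight (proj1 sx) (weight_space_e i vl) (generated_fspan _ gx sx) ev.
rewrite -subr_eq0 opprB addrC addrA subrK addrC -root_sum_cons => /eqP.
by move/root_sum_eq0.
Qed.

Section SubModuleElements.
Variables (V : lieModule (bkm r)) (N : submodule V).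

Lemma sub_singular mu (y : V) (yN : y \in Defs.sub_mem N) : singular mu y ->
  singular mu (Sub y yN : sub_module N).
Proof.
move=> [ym ye]; split=> [h|i]; apply/val_inj => /=.
  by rewrite ym.
by rewrite ye.
Qed.

End SubModuleElements.

(** At the first step containing [y] the image of [y] in the factor is nonzero and singular. Since
    [mu] is above [nu], that factor is some [L(eta)], and [irr_simple] forces [mu = eta]. *)
Lemma singular_occurs V mu nu (y : V) (J : local_JH V nu) :
  singular mu y -> y <> 0 -> weight_le nu mu -> jh_occurs J mu.
Proof.
move=> sy y0 numu.
have exj : exists j, (j <= jh_len J)%N && (y \in Defs.sub_mem (jh_sub J j)).
  by exists (jh_len J); rewrite leqnn jh_top.
case: (ex_minnP exj) => -[|j] /andP[jl yj] jmin.
  by move: yj; rewrite jh_bot => /eqP.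
have yNj : y \notin Defs.sub_mem (jh_sub J j).
  apply/negP => yj'; have := jmin j; rewrite yj' ltnn (ltnW jl).
  by move=> /(_ isT).
pose z : subquotient (jh_sub J j.+1) (jh_sub J j) :=
  quot_class (restr (jh_sub J j.+1) (jh_sub J j)) (Sub y yj : sub_module (jh_sub J j.+1)).
have sz : singular mu z.
  exact: (morph_singular (quot_class_morph _) (sub_singular _ sy)).
have z0 : z <> 0 by move/quot_class_eq0; apply/negP.
exists j; split=> //; case: (jh_factor jl) => [[eta [_ [f [fh fb]]]]|zP]; last first.
  by case: z0; apply: (zP mu numu); case: sz.
have mf : module_morph f by split=> *; [rewrite linearP | rewrite fh].
suff -> : mu = eta by exists f.
apply: (irr_simple (simple_irreducible eta) (morph_singular mf sz)).
by move=> fz0; apply: z0; apply: (bij_inj fb); rewrite fz0 linear0.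
Qed.

End WeightsOfIntegrable.

Theorem theorem3p2 (R : realType) (n : nat) (A : 'M[R]_n) (hA : BKM_Cartan A)
    (r : realization A) (lambda : weight r) (V : lieModule (bkm r))
    (hV : highest_weight_module lambda V) (hint : integrable lambda V) :
  wt V = \bigcup_(p in Indep lambda `\` holes lambda V)
           wt (simple_hw (shifted lambda p)) /\
  forall p, (Indep lambda `\` holes lambda V) p ->
    forall nu : weight r, weight_le nu (shifted lambda p) ->
      forall J : local_JH V nu, jh_occurs J (shifted lambda p).
Proof.
have [/quotient_singular[x sx gx] _] := hV.
have nonhole p : (Indep lambda `\` holes lambda V) p ->
    exists y : V, singular (shifted lambda p) y /\ y <> 0.
  case=> ip /not_andP[//|/existsNP[v /not_implyP[vl pv]]].
  exists (prod_f p v); split=> //; apply: prod_f_singular => //.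
  exact: (highest_weight_space_singular gx sx).
split=> [|p /nonhole[y [sy y0]] nu numu J]; last exact: singular_occurs sy y0 numu.
apply/seteqP; split=> [mu [w [wm w0]]|mu [p /nonhole[y [sy y0]] wL]].
  have [s sx0 ->] := fspan_weight (proj1 sx) wm (generated_fspan w gx sx) w0.
  have nV := integrable_real_nilpotent hA gx (proj1 sx) hint.
  have [p [ip px wp]] := integrable_weights hA nV gx sx sx0.
  (* The generator [x] itself shows that [p] is not a hole. *)
  by exists p => //; split=> // -[_ /(_ x (proj1 sx))].
have [s ys ->] := wt_simple_lift sy y0 wL.
by exists (fword s y); split=> //; apply: weight_space_fword; case: sy.
Qed.
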